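(* Let $M$ and $N$ be Banach manifolds, let $f: M \to N$ be a smooth map and let $m \in M$. Then $f$ can be brought into a normal form at $m$ if and only if the tangent map $T_m f: T_m M \to T_{f(m)} N$ is a regular operator. In particular, every smooth map between finite-dimensional manifolds can be brought into a normal form around every point.
   Context: Manifolds are smooth manifolds modeled on (possibly infinite-dimensional) locally convex spaces, with smoothness of maps between locally convex spaces in the usual Michal--Bastiani sense. A chart $\kappa: M \supseteq U' \to U \subseteq X$ at a point $m$ satisfies $\kappa(m) = 0$, with $U'$ an open neighborhood of $m$ and $U$ an open neighborhood of $0$ in the model space $X$. Regular operator: a continuous linear map $T: X \to Y$ between locally convex spaces is regular if it is relatively open (i.e. open onto its image) and its kernel and its image are closed, topologically complemented subspaces. Abstract normal form: a tuple $(X, Y, \hat f, f_{\mathrm{sing}})$ where (1) $X$ and $Y$ are locally convex spaces with topological decompositions $X = \mathrm{ker} \oplus \mathrm{coim}$ and $Y = \mathrm{coker} \oplus \mathrm{im}$ (here $\mathrm{ker}, \mathrm{coim}, \mathrm{coker}, \mathrm{im}$ are just names of the given subspaces); (2) $\hat f: \mathrm{coim} \to \mathrm{im}$ is a linear topological isomorphism; (3) $f_{\mathrm{sing}}: X \supseteq U \to \mathrm{coker}$ is a smooth map defined on an open neighborhood $U$ of $0$ in $X$ such that $f_{\mathrm{sing}}(0, x_2) = 0$ for all $x_2 \in U \cap \mathrm{coim}$ and such that the derivative $T_{(0,0)} f_{\mathrm{sing}}: X \to \mathrm{coker}$ vanishes. Set $f_{\mathrm{NF}}(x_1,x_2) =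 \hat f(x_2) + f_{\mathrm{sing}}(x_1,x_2)$ for $(x_1,x_2) \in U \subseteq \mathrm{ker} \oplus \mathrm{coim}$, so $f_{\mathrm{NF}}: X \supseteq U \to Y$. A smooth map $f: M \to N$ can be brought into the normal form $(X, Y, \hat f, f_{\mathrm{sing}})$ at $m \in M$ if there exist charts $\kappa: M \supseteq U' \to U \subseteq X$ at $m$ and $\rho: N \supseteq V' \to V \subseteq Y$ at $f(m)$ such that $f(U') \subseteq V'$, $f_{\mathrm{sing}}$ is defined on $U$ and $\rho \circ f|_{U'} \circ \kappa^{-1} = f_{\mathrm{NF}}$. It can be brought into a normal form at $m$ if this holds for some abstract normal form. *)

(* Defs.v *)
From HB Require Import structures.
From mathcomp Require Import all_boot all_order all_algebra.
From mathcomp Require Import all_classical all_reals all_analysis.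

Set Implicit Arguments.
Unset Strict Implicit.
Unset Printing Implicit Defensive.

Import Order.TTheory GRing.Theory Num.Theory.
Import numFieldNormedType.Exports.

Local Open Scope classical_set_scope.
Local Open Scope ring_scope.

(** * Michal-Bastiani calculus

    [tvsType R] is the library's type of locally convex spaces; it does not
    include the Hausdorff axiom, which is therefore required explicitly of
    model spaces and of the spaces of a normal form below. *)

Section calculus.
Context {R : realType} {X Y : tvsType R}.
Implicit Types (f : X -> Y) (x h : X) (y : Y).

Definition is_dderiv f x h y : Prop :=
  (t^-1 *: (f (t *: h + x) - f x) @[t --> (0 : R)^']) --> y.

(* The library's [derive] is the same limit, but only for normed modules. The
   value is 0 when the limit does not exist. *)
Definition dderiv f x h : Y := xget 0 [set y | is_dderiv f x h y].

Definition dderivable f x h : Prop := exists y, is_dderiv f x h y.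

End calculus.

(* Maps between the open sets are represented by total functions, of which only
   the values on [U] matter. The derivative is df : U x X -> Y, so that the next
   order takes place on the open subset U x X of X x X. *)
Fixpoint Cn_on {R : realType} (k : nat) {X Y : tvsType R} (U : set X)
    (f : X -> Y) : Prop :=
  if k is k'.+1 then
    [/\ {in U, continuous f},
        forall x h, U x -> dderivable f x h
      & Cn_on k' (U `*` [set: X]) (fun z : X * X => dderiv f z.1 z.2)]
  else {in U, continuous f}.

Definition smooth_on {R : realType} {X Y : tvsType R} (U : set X)
    (f : X -> Y) : Prop :=
  forall k, Cn_on k U f.

(** * Decompositions and regular operators *)

Section operators.
Context {R : realType}.

(* For subspaces A, B with X = A (+) B algebraically, the addition A x B -> X is
   a homeomorphism iff the projection p onto A along B is continuous. *)
Definition top_decomposition {X : tvsType R} (A B : set X) : Prop :=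
  [/\ submod_closed (mem A), submod_closed (mem B), A `&` B = [set 0]
    & exists2 p : X -> X, continuous p & forall x, A (p x) /\ B (x - p x)].

Definition top_complemented {X : tvsType R} (A : set X) : Prop :=
  exists B : set X, top_decomposition A B.

Definition relatively_open {X Y : tvsType R} (T : X -> Y) : Prop :=
  forall O : set X, open O ->
    exists2 V : set Y, open V & T @` O = V `&` range T.

Record regular_operator {X Y : tvsType R} (T : X -> Y) : Prop := {
  regular_linear : linear T ;
  regular_continuous : continuous T ;
  regular_open : relatively_open T ;
  regular_ker_closed : closed (T @^-1` [set 0]) ;
  regular_ker_complemented : top_complemented (T @^-1` [set 0]) ;
  regular_im_closed : closed (range T) ;
  regular_im_complemented : top_complemented (range T) }.

(* f restricts to a linear topological isomorphism from the subspace A onto the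
   subspace B. *)
Definition linear_homeo_on {X Y : tvsType R} (A : set X) (B : set Y)
    (f : X -> Y) : Prop :=
  [/\ forall (a : R) u v, A u -> A v -> f (a *: u + v) = a *: f u + f v,
      set_bij A B f,
      {within A, continuous f}
    & exists2 g : Y -> X, {within B, continuous g} & {in A, cancel f g}].

Definition finite_dimensional (V : lmodType R) : Prop :=
  exists (n : nat) (b : 'I_n -> V),
    forall v, exists a : 'I_n -> R, v = \sum_(i < n) a i *: b i.

End operators.

(** * Manifolds *)

(* A homeomorphism from an open subset of M onto an open subset of X. *)
Record chart {R : realType} (M : topologicalType) (X : tvsType R) := Chart {
  chart_map :> M -> X ;
  chart_inv : X -> M ;
  chart_dom : set M ;
  chart_cod : set X ;
  chart_dom_open : open chart_dom ;
  chart_cod_open : open chart_cod ;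
  chart_mapS : set_fun chart_dom chart_cod chart_map ;
  chart_invS : set_fun chart_cod chart_dom chart_inv ;
  chart_mapK : {in chart_dom, cancel chart_map chart_inv} ;
  chart_invK : {in chart_cod, cancel chart_inv chart_map} ;
  chart_map_continuous : {in chart_dom, continuous chart_map} ;
  chart_inv_continuous : {in chart_cod, continuous chart_inv} }.

Definition smooth_transition {R : realType} {M : topologicalType}
    {X Y : tvsType R} (c : chart M X) (d : chart M Y) : Prop :=
  smooth_on (chart_cod c `&` chart_inv c @^-1` chart_dom d)
            (d \o chart_inv c).

Definition compatible {R : realType} {M : topologicalType} {X Y : tvsType R}
    (c : chart M X) (d : chart M Y) : Prop :=
  smooth_transition c d /\ smooth_transition d c.

(* Smooth manifolds modeled on E. [chart_at] selects, for every point, a chart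
   of the atlas around it; it witnesses that the atlas covers the manifold and
   serves to represent tangent vectors. *)
Record manifold {R : realType} (E : tvsType R) := Manifold {
  carrier :> topologicalType ;
  atlas : set (chart carrier E) ;
  chart_at : carrier -> chart carrier E ;
  chart_at_atlas : forall m, atlas (chart_at m) ;
  chart_at_dom : forall m, chart_dom (chart_at m) m ;
  atlas_compatible : forall c d, atlas c -> atlas d -> compatible c d ;
  carrier_hausdorff : hausdorff_space carrier ;
  model_hausdorff : hausdorff_space E }.

(* Membership in the maximal atlas. The space X in which c takes its values
   need not be the model space E itself. *)
Definition smooth_chart {R : realType} {E : tvsType R} (M : manifold E)
    {X : tvsType R} (c : chart M X) : Prop :=
  forall d, atlas d -> compatible c d.

Section maps.
Context {R : realType} {E F : tvsType R} {M : manifold E} {N : manifold F}.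

Definition smooth_map (f : M -> N) : Prop :=
  continuous f /\
  forall (c : chart M E) (d : chart N F), atlas c -> atlas d ->
    smooth_on (chart_cod c `&` (f \o chart_inv c) @^-1` chart_dom d)
              (d \o f \o chart_inv c).

End maps.

(* A tangent vector at m is given by its coordinate v in the chart
   c = chart_at m; it is the class of the curves gamma through m with
   (c o gamma)'(0) = v. The coordinate in any other chart c' around m is
   d(c' o c^-1)(c m) v, so another choice of [chart_at] changes the tangent
   spaces, and the tangent maps accordingly, by linear homeomorphisms. *)
Definition tangent_space {R : realType} {E : tvsType R} (M : manifold E)
  (m : M) : Type := E.

HB.instance Definition _ {R : realType} {E : tvsType R} (M : manifold E)
  (m : M) := Tvs.on (tangent_space m).

Definition tangent_map {R : realType} {E F : tvsType R} {M : manifold E}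
    {N : manifold F} (f : M -> N) (m : M) :
    tangent_space m -> tangent_space (f m) :=
  fun v => dderiv (chart_at (f m) \o f \o chart_inv (chart_at m))
                  (chart_at m m) v.
Arguments tangent_map {R E F M N} f m _.

(** * Normal forms *)

(* [nf_ker], [nf_coim], [nf_coker], [nf_im] are names of the given subspaces.
   [nf_hat] and [nf_sing] are total functions, meaningful on [nf_coim] and on
   [nf_dom] respectively. *)
Record normal_form (R : realType) := NormalForm {
  nf_X : tvsType R ;
  nf_Y : tvsType R ;
  nf_X_hausdorff : hausdorff_space nf_X ;
  nf_Y_hausdorff : hausdorff_space nf_Y ;
  nf_ker : set nf_X ;
  nf_coim : set nf_X ;
  nf_coker : set nf_Y ;
  nf_im : set nf_Y ;
  nf_X_decomposition : top_decomposition nf_ker nf_coim ;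
  nf_Y_decomposition : top_decomposition nf_coker nf_im ;
  nf_hat : nf_X -> nf_Y ;
  nf_hat_iso : linear_homeo_on nf_coim nf_im nf_hat ;
  nf_dom : set nf_X ;
  nf_dom_open : open nf_dom ;
  nf_dom0 : nf_dom 0 ;
  nf_sing : nf_X -> nf_Y ;
  nf_singS : set_fun nf_dom nf_coker nf_sing ;
  nf_sing_smooth : smooth_on nf_dom nf_sing ;
  nf_sing_coim : forall x2, nf_dom x2 -> nf_coim x2 -> nf_sing x2 = 0 ;
  nf_sing_deriv0 : forall h, is_dderiv nf_sing 0 h 0 }.

Arguments nf_ker {R} n _.
Arguments nf_coim {R} n _.
Arguments nf_coker {R} n _.
Arguments nf_im {R} n _.
Arguments nf_hat {R} n _.
Arguments nf_dom {R} n _.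
Arguments nf_sing {R} n _.

Definition brought_into {R : realType} {E F : tvsType R} {M : manifold E}
    {N : manifold F} (f : M -> N) (m : M) (nf : normal_form R) : Prop :=
  exists (kappa : chart M (nf_X nf)) (rho : chart N (nf_Y nf)),
    [/\ smooth_chart kappa /\ smooth_chart rho,
        chart_dom kappa m /\ kappa m = 0,
        chart_dom rho (f m) /\ rho (f m) = 0,
        set_fun (chart_dom kappa) (chart_dom rho) f /\
        chart_cod kappa `<=` nf_dom nf
      & forall x1 x2, nf_ker nf x1 -> nf_coim nf x2 -> chart_cod kappa (x1 + x2) ->
          rho (f (chart_inv kappa (x1 + x2))) =
          nf_hat nf x2 + nf_sing nf (x1 + x2)].

Definition has_normal_form {R : realType} {E F : tvsType R} {M : manifold E}
    {N : manifold F} (f : M -> N) (m : M) : Prop :=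
  exists nf : normal_form R, brought_into f m nf.

(* Main.v *)
Require Import Defs.
From HB Require Import structures.
From mathcomp Require Import all_boot all_order all_algebra.
From mathcomp Require Import all_classical all_reals all_analysis.
From mathcomp Require Import ring lra.

(* If T has a continuous linear generalized inverse S (T S T = T), then S T and
   T S are continuous projections which give all complements, and T is open onto
   its image; conversely a regular operator has such an S, built from the two
   complements.

   Let T be the derivative at 0 of a local representative g of f, with S T S = S.
   The map phi(x) = x - S T x + S g(x) has derivative id at 0, hence is a local
   diffeomorphism when the source is Banach, and gt = g o phi^-1 satisfies
   T S gt(z) = T z. The shear psi(y) = y - (id - T S) gt(S y) of the target then
   gives psi(gt(z)) = T z + (id - T S)(gt(z) - gt(S T z)), which is a normal form.
   Conversely, the derivative of a normal form at 0 is hat o pr_coim, which has a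
   generalized inverse, and T_m f is conjugate to it by the derivatives of the
   charts.

   The inverse function theorem in the Michal-Bastiani setting rests on two
   facts: a C^2 map between normed spaces is strictly Frechet differentiable, and
   the tangent lift of a diffeomorphism is a diffeomorphism, so that smoothness of
   the inverse follows by induction on the order. For finite-dimensional model
   spaces, S is obtained from a pseudo-inverse matrix. *)

Set Implicit Arguments.
Unset Strict Implicit.
Unset Printing Implicit Defensive.

Import Order.TTheory GRing.Theory Num.Theory.
Import numFieldNormedType.Exports.

Local Open Scope classical_set_scope.
Local Open Scope ring_scope.

(** * Calculus in locally convex spaces *)

Section tvs_topology.
Context {R : realType}.
Implicit Types X Y : tvsType R.

Definition convex {X : lmodType R} (A : set X) : Prop :=
  forall (s : R) a b, 0 <= s <= 1 -> A a -> A b -> A (s *: a + (1 - s) *: b).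

(** Local convexity enters here; it makes [mean_value_convex] usable in small neighborhoods of a
    derivative. *)
Lemma nbhs_open_convex X (x : X) (U : set X) : nbhs x U ->
  exists V : set X, [/\ open V, convex V, V x & V `<=` U].
Proof.
move=> Ux; have [B Bc [Bo Bb]] := @locally_convex R X.
have [V [BV Vx] VU] := Bb x U Ux.
exists V; split=> //; first exact: Bo.
move=> s a b s01 Va Vb.
have := Bc V (mem_set BV) a b (Itv01 (andP s01).1 (andP s01).2) (mem_set Va) (mem_set Vb).
by rewrite inE.
Qed.

Lemma near_eq_cvg_to T (X : topologicalType) (F : set_system T) {FF : Filter F}
    (f g : T -> X) (a : X) :
  (\forall t \near F, f t = g t) -> f t @[t --> F] --> a -> g t @[t --> F] --> a.
Proof. by move=> fg; apply: cvg_trans; apply: near_eq_cvg; move: fg; apply: filterS. Qed.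

Lemma cvg_to_pair T (X Y : topologicalType) (F : set_system T) {FF : Filter F}
    (f : T -> X) (g : T -> Y) (a : X) (b : Y) :
  f t @[t --> F] --> a -> g t @[t --> F] --> b -> (f t, g t) @[t --> F] --> (a, b).
Proof.
move=> fa gb A [[B C] /= [Ba Cb] BC].
have fB : F (f @^-1` B) := fa _ Ba.
have gC : F (g @^-1` C) := gb _ Cb.
change (F ((fun t => (f t, g t)) @^-1` A)).
by apply: filterS2 fB gC => t Bt Ct; exact: (BC (f t, g t)).
Qed.

Lemma tvs_cvgD X T (F : set_system T) {FF : Filter F} (f g : T -> X) (a b : X) :
  f x @[x --> F] --> a -> g x @[x --> F] --> b ->
  (f x + g x) @[x --> F] --> a + b.
Proof. by move=> fa gb; apply: (cvg_comp2 fa gb (add_continuous (a, b))). Qed.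

Lemma tvs_cvgZ X T (F : set_system T) {FF : Filter F} (s : T -> R) (f : T -> X) (r : R) (a : X) :
  s x @[x --> F] --> r -> f x @[x --> F] --> a ->
  (s x *: f x) @[x --> F] --> r *: a.
Proof.
move=> sr fa A /(@scale_continuous R X (r, a)) [[B C] /= [Br Ca] BC].
have sB : F (s @^-1` B) := sr _ Br.
have fC : F (f @^-1` C) := fa _ Ca.
change (F ((fun x => s x *: f x) @^-1` A)).
by apply: filterS2 sB fC => x Bx Cx; exact: (BC (s x, f x)).
Qed.

Lemma tvs_cvgB X T (F : set_system T) {FF : Filter F} (f g : T -> X) (a b : X) :
  f x @[x --> F] --> a -> g x @[x --> F] --> b ->
  (f x - g x) @[x --> F] --> a - b.
Proof.
move=> fa gb; have := tvs_cvgD fa (tvs_cvgZ (cvg_cst (-1 : R)) gb).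
under eq_fun do rewrite scaleN1r.
by rewrite scaleN1r; apply.
Qed.

Lemma prod_hausdorff (X Y : topologicalType) :
  hausdorff_space X -> hausdorff_space Y -> hausdorff_space (X * Y)%type.
Proof.
move=> hX hY [x y] [x' y'] xy; congr pair.
- apply: hX => A B Ax Bx.
  have [||[u v] /= [[? _] [? _]]] := xy (A `*` setT) (B `*` setT).
  + by exists (A, setT) => //; split => //; exact: filterT.
  + by exists (B, setT) => //; split => //; exact: filterT.
  + by exists u.
- apply: hY => A B Ay By.
  have [||[u v] /= [[_ ?] [_ ?]]] := xy (setT `*` A) (setT `*` B).
  + by exists (setT, A) => //; split => //; exact: filterT.
  + by exists (setT, B) => //; split => //; exact: filterT.
  + by exists v.
Qed.

Lemma openI_preimage (X Y : topologicalType) (U : set X) (V : set Y) (f : X -> Y) :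
  open U -> open V -> {in U, continuous f} -> open (U `&` f @^-1` V).
Proof.
move=> oU oV fc; rewrite openE => x [Ux Vfx].
apply: filterI; first exact: open_nbhs_nbhs.
by apply: (fc x (mem_set Ux)); exact: open_nbhs_nbhs.
Qed.

End tvs_topology.

(** * Directional derivatives *)

Section directional_derivative.
Context {R : realType}.
Implicit Types X Y Z : tvsType R.

Lemma dnbhs0_cvg0 : (fun t : R => t) @ (0 : R)^' --> (0 : R).
Proof. exact: nbhs_dnbhs. Qed.

Lemma line_cvg X (x h : X) : (t *: h + x) @[t --> (0 : R)^'] --> x.
Proof.
rewrite -[in X in _ --> X](add0r x) -(scale0r h).
by apply: tvs_cvgD; [apply: tvs_cvgZ; [exact: dnbhs0_cvg0|exact: cvg_cst]|exact: cvg_cst].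
Qed.

Lemma is_dderiv_unique X Y (f : X -> Y) x h y y' : hausdorff_space Y ->
  is_dderiv f x h y -> is_dderiv f x h y' -> y = y'.
Proof. by move=> hY fy fy'; exact: (cvg_unique hY fy fy'). Qed.

Lemma is_dderivE X Y (f : X -> Y) x h y : hausdorff_space Y ->
  is_dderiv f x h y -> dderiv f x h = y.
Proof.
move=> hY fy; apply: (is_dderiv_unique hY _ fy); rewrite /dderiv.
exact: (@xgetPex _ 0 [set y | is_dderiv f x h y]) (ex_intro _ y fy).
Qed.

Lemma dderivableP X Y (f : X -> Y) x h :
  dderivable f x h -> is_dderiv f x h (dderiv f x h).
Proof. by move=> fx; exact: (@xgetPex _ 0 [set y | is_dderiv f x h y]). Qed.

(** The line [t *: h + x] tends to [x], so a derivative depends only on the germ at [x]; total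
    functions can thus represent local maps. *)
Lemma near_eq_is_dderiv X Y (f g : X -> Y) x h y :
  (\forall z \near x, f z = g z) -> is_dderiv f x h y -> is_dderiv g x h y.
Proof.
move=> fg; apply: near_eq_cvg_to.
have fgx := nbhs_singleton fg.
have : \forall t \near (0 : R)^', f (t *: h + x) = g (t *: h + x).
  exact: line_cvg fg.
by apply: filterS => t ->; rewrite fgx.
Qed.

Lemma near_eq_dderiv X Y (f g : X -> Y) x h :
  (\forall z \near x, f z = g z) -> dderiv f x h = dderiv g x h.
Proof.
move=> fg; rewrite /dderiv; congr xget; apply/seteqP; split=> y.
  exact: near_eq_is_dderiv.
by apply: near_eq_is_dderiv; move: fg; apply: filterS => z ->.
Qed.

Lemma is_dderivZ X Y (f : X -> Y) x h y (a : R) :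
  is_dderiv f x h y -> is_dderiv f x (a *: h) (a *: y).
Proof.
have [->|a0] := eqVneq a 0 => fy.
  rewrite /is_dderiv !scale0r; apply: near_eq_cvg_to (cvg_cst (0 : Y)).
  by apply: nearW => t /=; rewrite scaler0 add0r subrr scaler0.
have at0 : (t * a) @[t --> (0 : R)^'] --> (0 : R)^'.
  move=> A /= [e e0 eA]; exists (e / `|a|); first by rewrite /= divr_gt0 ?normr_gt0.
  move=> t /=; rewrite sub0r normrN => te t0.
  apply: eA; last by rewrite mulf_neq0.
  by rewrite /= sub0r normrN normrM -ltr_pdivlMr // normr_gt0.
rewrite /is_dderiv.
apply: near_eq_cvg_to (tvs_cvgZ (cvg_cst (a : R)) (cvg_comp (fun t : R => t * a) _ at0 fy)).
near=> t.
have t0 : t != 0 by near: t; exact: nbhs_dnbhs_neq.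
by rewrite /= !scalerA invfM mulrCA divff // mulr1.
Unshelve. all: by end_near. Qed.

Lemma dderivZ X Y (f : X -> Y) x h (a : R) : hausdorff_space Y ->
  dderivable f x h -> dderiv f x (a *: h) = a *: dderiv f x h.
Proof. by move=> hY /dderivableP fx; apply: is_dderivE => //; exact: is_dderivZ. Qed.

Lemma is_dderiv_pair X Y Z (f : X -> Y) (g : X -> Z) x h y z :
  is_dderiv f x h y -> is_dderiv g x h z ->
  is_dderiv (fun x => (f x, g x)) x h (y, z).
Proof.
move=> fy gz; rewrite /is_dderiv.
by apply: near_eq_cvg_to (cvg_to_pair fy gz); exact: nearW.
Qed.

Lemma lin0 X Y (f : X -> Y) : linear f -> f 0 = 0.
Proof.
move=> lf; have := lf 1 0 0; rewrite scaler0 addr0 scale1r.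
by move/(congr1 (fun z => z - f 0)); rewrite subrr addrK.
Qed.

Lemma linZ X Y (f : X -> Y) (a : R) x : linear f -> f (a *: x) = a *: f x.
Proof. by move=> lf; rewrite -[a *: x]addr0 lf lin0 // addr0. Qed.

Lemma linD X Y (f : X -> Y) x y : linear f -> f (x + y) = f x + f y.
Proof. by move=> lf; have := lf 1 x y; rewrite !scale1r. Qed.

Lemma linN X Y (f : X -> Y) x : linear f -> f (- x) = - f x.
Proof. by move=> lf; rewrite -scaleN1r linZ // scaleN1r. Qed.

Lemma linB X Y (f : X -> Y) x y : linear f -> f (x - y) = f x - f y.
Proof. by move=> lf; rewrite linD // linN. Qed.

Lemma is_dderiv_linear X Y (f : X -> Y) x h : linear f -> is_dderiv f x h (f h).
Proof.
move=> lf; rewrite /is_dderiv; apply: near_eq_cvg_to (cvg_cst (f h)); near=> t.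
have t0 : t != 0 by near: t; exact: nbhs_dnbhs_neq.
by rewrite lf addrK scalerA mulVf // scale1r.
Unshelve. all: by end_near. Qed.

Lemma is_dderiv_cst X Y (c : Y) (x h : X) : is_dderiv (fun=> c) x h 0.
Proof.
rewrite /is_dderiv; apply: near_eq_cvg_to (cvg_cst (0 : Y)).
by apply: nearW => t /=; rewrite subrr scaler0.
Qed.

End directional_derivative.

(** * Mean value theorem for convex open sets *)

Section mean_value.
Context {R : realType} {Y : tvsType R}.

(** A supremum argument takes the place of separating functionals: slopes over adjacent intervals
    combine convexly, so the set of [u] whose slope from 0 lies in [V] reaches 1. *)
Lemma mean_value_convex (g : R^o -> Y) (V : set Y) : open V -> convex V ->
  (forall s, 0 <= s <= 1 -> exists2 v, V v & is_dderiv g s 1 v) ->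
  V (g 1 - g 0).
Proof.
move=> oV cV gV.
pose slope (s u : R) := (u - s)^-1 *: (g u - g s).
have slopeC s u : slope u s = slope s u.
  by rewrite /slope -opprB invrN -[g s - _]opprB scaleNr scalerN opprK.
(* The slope over two adjacent intervals is the convex combination of their slopes, weighted by
   relative length. *)
have slope_trans s t u : s < t -> t < u ->
    V (slope s t) -> V (slope t u) -> V (slope s u).
  move=> st tu Vst Vtu; have su := lt_trans st tu.
  have l01 : 0 <= (t - s) / (u - s) <= 1.
    by rewrite divr_ge0 ?ler_pdivrMr ?subr_gt0 ?subr_ge0 ?mul1r ?lerD2r ?ltW.
  have := cV _ _ _ l01 Vst Vtu; rewrite /slope !scalerA.
  have -> : (t - s) / (u - s) * (t - s)^-1 = (u - s)^-1.
    by field; rewrite !subr_eq0 !gt_eqF.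
  have -> : (1 - (t - s) / (u - s)) * (u - t)^-1 = (u - s)^-1.
    by field; rewrite !subr_eq0 !gt_eqF.
  by rewrite -scalerDr [X in _ *: X]addrC addrA subrK.
(* As [V] is open, short slopes with one end at [s] lie in [V], on either side of [s]. *)
have local s : 0 <= s <= 1 -> exists2 d : R, 0 < d &
    forall u, 0 < `|u - s| < d -> V (slope s u).
  move=> /gV [v Vv gsv].
  have [d /= d0 dV] := gsv V (open_nbhs_nbhs (conj oV Vv)).
  exists d => // u /andP[us ud]; have := dV (u - s).
  rewrite /= sub0r normrN => /(_ ud); rewrite -normr_gt0 => /(_ us).
  by rewrite /slope /GRing.scale /= mulr1 subrK.
pose S : set R := [set u | 0 < u <= 1 /\ V (slope 0 u)].
have ubS : ubound S 1 by move=> u [/andP[]].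
have [u0 Su0] : S !=set0.
  have [d d0 dV] : exists2 d : R, 0 < d &
      forall u, 0 < `|u - 0| < d -> V (slope 0 u) by apply: local; rewrite lexx ler01.
  exists (Num.min (d / 2) 1); split.
    by rewrite lt_min divr_gt0 //= ltr01 ge_min lexx orbT.
  have m0 : 0 < Num.min (d / 2) 1 by rewrite lt_min divr_gt0 //= ltr01.
  by apply: dV; rewrite subr0 gtr0_norm // m0 gt_min ltr_pdivrMr // ltr_pMr // ltr1n.
have hS : has_sup S by split; [exists u0|exists 1].
pose b := sup S.
have b0 : 0 < b.
  by have [/andP[u00 _] _] := Su0; apply: lt_le_trans u00 _; exact: sup_ubound hS.2 _ _.
have b1 : b <= 1 by apply: ge_sup => //; exists u0.
have [d d0 dV] : exists2 d : R, 0 < d &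
    forall u, 0 < `|u - b| < d -> V (slope b u) by apply: local; rewrite (ltW b0).
(* The supremum is attained: a point of [S] within [d] of [b] is joined to [b] by a short slope. *)
have Sb : S b.
  have [s Ss bs] := sup_adherent d0 hS.
  have sb : s <= b by exact: sup_ubound hS.2 _ _.
  have [<-//|nsb] := eqVneq s b.
  have ltsb : s < b by rewrite lt_neqAle nsb.
  split; first by rewrite b0.
  apply: slope_trans (proj2 Ss) _ => //; first by have [/andP[]] := Ss.
  rewrite -slopeC; apply: dV; rewrite distrC gtr0_norm ?subr_gt0 // ltsb /=.
  by rewrite ltrBlDl -ltrBlDr.
have [b1'|b1'] := eqVneq b 1.
  by have [_] := Sb; rewrite b1' /slope subr0 invr1 scale1r.
have ltb1 : b < 1 by rewrite lt_neqAle b1'.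
(* If [b < 1], a short slope to the right of [b] puts a larger point into [S]. *)
pose u := Num.min (b + d / 2) 1.
have bu : b < u by rewrite /u lt_min ltb1 ltrDl divr_gt0.
have : S u.
  split; first by rewrite (lt_trans b0 bu) /= /u ge_min lexx orbT.
  apply: slope_trans (proj2 Sb) _ => //; apply: dV.
  rewrite gtr0_norm ?subr_gt0 // bu /= ltrBlDl /u gt_min ltrD2l.
  by rewrite ltr_pdivrMr // ltr_pMr // ltr1n.
by move=> /(sup_ubound hS.2); rewrite leNgt bu.
Qed.

End mean_value.

(** * Continuously differentiable maps and the chain rule *)

Section C1.
Context {R : realType}.
Implicit Types X Y Z : tvsType R.

(* The mean value theorem along the segment from [x_ i] to
   [t_ i *: h_ i + x_ i] compares the quotient with values of the derivative
   near [(x, h)]. *)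
Lemma strict_dderiv X Y (U : set X) (f : X -> Y) (x h : X) T (F : set_system T)
    {FF : Filter F} (t_ : T -> R) (x_ h_ : T -> X) :
  open U -> U x -> Cn_on 1 U f ->
  t_ i @[i --> F] --> (0 : R) -> (\forall i \near F, t_ i != 0) ->
  x_ i @[i --> F] --> x -> h_ i @[i --> F] --> h ->
  ((t_ i)^-1 *: (f (t_ i *: h_ i + x_ i) - f (x_ i))) @[i --> F] --> dderiv f x h.
Proof.
move=> oU Ux [fc fd dfc] t0 tn0 xx hh W /nbhs_open_convex[V [oV cV Vd VW]].
have Uxh : (x, h) \in U `*` [set: X] by rewrite inE.
have := dfc _ Uxh V (open_nbhs_nbhs (conj oV Vd)).
move=> [[A B] /= [Ax Bh] AB].
(* Convexity of [A'] keeps the whole segment inside [U], where the derivative stays in [V]. *)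
have [A' [oA' cA' A'x A'U]] := nbhs_open_convex (filterI Ax (open_nbhs_nbhs (conj oU Ux))).
have nA' : nbhs x A' by exact: open_nbhs_nbhs.
have yx : (t_ i *: h_ i + x_ i) @[i --> F] --> x.
  by rewrite -[X in _ --> X]add0r -(scale0r h); apply: tvs_cvgD => //; exact: tvs_cvgZ.
have xA : \forall i \near F, A' (x_ i) by exact: xx.
have yA : \forall i \near F, A' (t_ i *: h_ i + x_ i) by exact: yx.
have hB : \forall i \near F, B (h_ i) by exact: hh.
change (F ((fun i => (t_ i)^-1 *: (f (t_ i *: h_ i + x_ i) - f (x_ i))) @^-1` W)).
near=> i.
have ti : t_ i != 0 by near: i.
have Axi : A' (x_ i) by near: i.
have Ayi : A' (t_ i *: h_ i + x_ i) by near: i.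
have Bhi : B (h_ i) by near: i.
apply: VW.
pose g (s : R^o) := (t_ i)^-1 *: f (s *: (t_ i *: h_ i) + x_ i).
have -> : (t_ i)^-1 *: (f (t_ i *: h_ i + x_ i) - f (x_ i)) = g 1 - g 0.
  by rewrite /g scale1r scale0r add0r scalerBr.
apply: mean_value_convex oV cV _ => s s01.
set p := s *: (t_ i *: h_ i) + x_ i.
have Ap : A' p.
  have := cA' s _ _ s01 Ayi Axi; rewrite scalerDr -addrA -scalerDl.
  by rewrite [s + _]addrC subrK scale1r.
have [Ap' Up] := A'U _ Ap.
exists (dderiv f p (h_ i)); first exact: (AB (p, h_ i)).
(* The derivative of [g] is [(t_ i)^-1] times that of [f] in direction [t_ i *: h_ i]; homogeneity
   cancels the factor. *)
have := is_dderivZ (a := t_ i) (dderivableP (fd p (h_ i) Up)).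
rewrite /is_dderiv => dp.
rewrite -[dderiv f p (h_ i)](scalerK ti).
apply: near_eq_cvg_to (tvs_cvgZ (cvg_cst ((t_ i)^-1)) dp); apply: nearW => r.
have -> : g (r *: (1 : R^o) + s) = (t_ i)^-1 *: f (r *: (t_ i *: h_ i) + p).
  by rewrite /g /p addrA -scalerDl -[r *: _]/(r * 1) mulr1.
by rewrite -[g s]/((t_ i)^-1 *: f p) -scalerBr !scalerA mulrC.
Unshelve. all: by end_near. Qed.

(** The difference quotients of [f] are moving directions that converge to [k], so [strict_dderiv]
    applies to [g] at the fixed point [f x]. *)
Lemma is_dderiv_comp X Y Z (V : set Y) (g : Y -> Z) (f : X -> Y) x h k :
  open V -> V (f x) -> Cn_on 1 V g -> is_dderiv f x h k ->
  is_dderiv (g \o f) x h (dderiv g (f x) k).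
Proof.
move=> oV Vfx gC fk.
have tn0 : \forall t \near (0 : R)^', t != 0 by exact: nbhs_dnbhs_neq.
rewrite /is_dderiv.
apply: near_eq_cvg_to (strict_dderiv oV Vfx gC dnbhs0_cvg0 tn0 (cvg_cst (f x)) fk).
apply: filterS tn0 => t t0 /=.
by rewrite scalerA divff // scale1r subrK.
Qed.

(** Additivity comes from splitting the increment at [t *: v + x], a moving base point of the kind
    that [strict_dderiv] allows. *)
Lemma Cn1_dderiv_linear X Y (U : set X) (f : X -> Y) x : hausdorff_space Y ->
  open U -> Cn_on 1 U f -> U x -> linear (dderiv f x).
Proof.
move=> hY oU fC Ux a u v.
have [_ fd _] := fC.
have tn0 : \forall t \near (0 : R)^', t != 0 by exact: nbhs_dnbhs_neq.
rewrite -(dderivZ a hY (fd x u Ux)); apply: is_dderivE => //.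
have du : (t^-1 *: (f (t *: (a *: u) + (t *: v + x)) - f (t *: v + x)))
    @[t --> (0 : R)^'] --> dderiv f x (a *: u).
  apply: (@strict_dderiv X Y U f x (a *: u) R _ _ id (fun t => t *: v + x) (fun=> a *: u)) => //.
  - exact: dnbhs0_cvg0.
  - exact: line_cvg.
  - exact: cvg_cst.
rewrite /is_dderiv; apply: near_eq_cvg_to (tvs_cvgD du (dderivableP (fd x v Ux))).
apply: nearW => t.
by rewrite -scalerDr addrA subrK [t *: (_ + v)]scalerDr addrA.
Qed.

Lemma Cn1_dderiv_continuous X Y (U : set X) (f : X -> Y) x :
  Cn_on 1 U f -> U x -> continuous (dderiv f x).
Proof.
move=> [_ _ dfc] Ux h; have Uxh : (x, h) \in U `*` [set: X] by rewrite inE.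
have xh : (x, h') @[h' --> h] --> (x, h).
  by apply: cvg_to_pair; [exact: cvg_cst|exact: cvg_id].
exact: (cvg_comp _ _ xh (dfc _ Uxh)).
Qed.

End C1.

(** * Stability properties of maps of class C^k *)

Section Cn_calculus.
Context {R : realType}.
Implicit Types X Y Z : tvsType R.

Lemma Cn_on_subset X Y k (U V : set X) (f : X -> Y) :
  V `<=` U -> Cn_on k U f -> Cn_on k V f.
Proof.
elim: k X Y U V f => [|k IH] X Y U V f VU /=.
  by move=> fc x; rewrite inE => /VU Ux; apply: fc; rewrite inE.
move=> [fc fd df]; split.
- by move=> x; rewrite inE => /VU Ux; apply: fc; rewrite inE.
- by move=> x h /VU; exact: fd.
- by apply: IH df => -[x h] [/VU].
Qed.

Lemma Cn_on_pred X Y k (U : set X) (f : X -> Y) : Cn_on k.+1 U f -> Cn_on k U f.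
Proof.
elim: k X Y U f => [|k IH] X Y U f; first by case.
by move=> [fc fd df]; split => //; exact: IH df.
Qed.

Lemma Cn_on_le X Y k l (U : set X) (f : X -> Y) : (k <= l)%N ->
  Cn_on l U f -> Cn_on k U f.
Proof.
move=> /subnK <-; elim: (l - k)%N => // j IH; rewrite addSn => /Cn_on_pred.
exact: IH.
Qed.

Lemma open_prodT (X X' : topologicalType) (U : set X) : open U -> open (U `*` [set: X']).
Proof.
move=> oU; rewrite openE => -[x h] [/= Ux _].
by exists (U, setT) => //; split; [exact: open_nbhs_nbhs|exact: filterT].
Qed.

Lemma open_near_eq (X : topologicalType) (Y : Type) (U : set X) (f g : X -> Y) x : open U -> U x ->
  {in U, f =1 g} -> \forall z \near x, f z = g z.
Proof.
move=> oU Ux fg; apply: filterS (open_nbhs_nbhs (conj oU Ux)) => z Uz.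
by apply: fg; rewrite inE.
Qed.

Lemma eq_continuous_in (X : topologicalType) (Y : topologicalType) (U : set X) (f g : X -> Y) :
  open U -> {in U, f =1 g} -> {in U, continuous f} -> {in U, continuous g}.
Proof.
move=> oU fg fc x Ux; have Ux' : U x by rewrite inE in Ux.
rewrite /continuous_at -(fg x Ux); apply: near_eq_cvg_to (fc x Ux).
exact: open_near_eq oU Ux' fg.
Qed.

(** Openness of [U] turns agreement on [U] into agreement of germs, hence of derivatives of every
    order. *)
Lemma eq_Cn_on X Y k (U : set X) (f g : X -> Y) : open U ->
  {in U, f =1 g} -> Cn_on k U f -> Cn_on k U g.
Proof.
elim: k X Y U f g => [|k IH] X Y U f g oU fg /=; first exact: eq_continuous_in.
move=> [fc fd df]; split; first exact: eq_continuous_in fc.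
- move=> x h Ux; have [y fy] := fd x h Ux; exists y.
  by apply: near_eq_is_dderiv fy; exact: open_near_eq oU Ux fg.
- apply: IH df; first exact: open_prodT.
  move=> [x h]; rewrite inE => -[/= Ux _].
  by apply: near_eq_dderiv; exact: open_near_eq oU Ux fg.
Qed.

Lemma dderiv_lin X Y (f : X -> Y) x h : hausdorff_space Y -> linear f ->
  dderiv f x h = f h.
Proof. by move=> hY lf; apply: is_dderivE => //; exact: is_dderiv_linear. Qed.

(** The derivative is [f \o snd], again linear and continuous, so the induction closes. *)
Lemma Cn_on_lin X Y k (U : set X) (f : X -> Y) : hausdorff_space Y ->
  linear f -> continuous f -> Cn_on k U f.
Proof.
move=> hY; elim: k X U f => [|k IH] X U f lf fc /=; first by move=> x _; exact: fc.
split; first by move=> x _; exact: fc.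
- by move=> x h _; exists (f h); exact: is_dderiv_linear.
- have -> : (fun z : X * X => dderiv f z.1 z.2) = f \o snd.
    by apply/funext => z /=; exact: dderiv_lin.
  apply: IH; first by move=> a u v /=; exact: lf.
  by move=> z; apply: continuous_comp; [exact: cvg_snd|exact: fc].
Qed.

Lemma Cn_on_cst X Y k (U : set X) (c : Y) : hausdorff_space Y ->
  Cn_on k U (fun=> c).
Proof.
move=> hY; elim: k X U c => [|k IH] X U c /=; first by move=> x _; exact: cvg_cst.
split; first by move=> x _; exact: cvg_cst.
- by move=> x h _; exists 0; exact: is_dderiv_cst.
- have -> : (fun z : X * X => dderiv (fun=> c) z.1 z.2) = (fun=> 0).
    by apply/funext => z /=; apply: is_dderivE => //; exact: is_dderiv_cst.
  exact: IH.
Qed.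

Lemma Cn_on_pair X Y Z k (U : set X) (f : X -> Y) (g : X -> Z) :
  hausdorff_space Y -> hausdorff_space Z -> open U ->
  Cn_on k U f -> Cn_on k U g -> Cn_on k U (fun x => (f x, g x)).
Proof.
move=> hY hZ; elim: k X U f g => [|k IH] X U f g oU /=.
  by move=> fc gc x Ux; apply: cvg_to_pair; [exact: fc|exact: gc].
move=> [fc fd df] [gc gd dg]; split.
- by move=> x Ux; apply: cvg_to_pair; [exact: fc|exact: gc].
- move=> x h Ux; have [y fy] := fd x h Ux; have [z gz] := gd x h Ux.
  by exists (y, z); exact: is_dderiv_pair.
- have := IH _ _ _ _ (@open_prodT _ X _ oU) df dg; apply: eq_Cn_on.
    exact: open_prodT.
  move=> [x h]; rewrite inE => -[/= Ux _]; apply/esym/is_dderivE.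
    exact: prod_hausdorff.
  by apply: is_dderiv_pair; apply: dderivableP; [exact: fd|exact: gd].
Qed.

(** By the chain rule the derivative of [g \o f] is the derivative of [g], as a map of two
    variables, after the lift [Tf]; both are of order [k]. *)
Lemma Cn_on_comp X Y Z k (U : set X) (V : set Y) (g : Y -> Z) (f : X -> Y) :
  hausdorff_space X -> hausdorff_space Y -> hausdorff_space Z ->
  open U -> open V -> set_fun U V f ->
  Cn_on k V g -> Cn_on k U f -> Cn_on k U (g \o f).
Proof.
elim: k X Y Z U V g f => [|k IH] X Y Z U V g f hX hY hZ oU oV fUV.
  move=> /= gc fc x Ux; apply: continuous_comp; first exact: fc.
  by apply: gc; rewrite inE; apply: fUV; rewrite inE in Ux.
move=> gC fC; have gC1 := Cn_on_le (isT : (1 <= k.+1)%N) gC.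
have [gc gd dg] := gC; have [fc fd df] := fC; split.
- move=> x Ux; apply: continuous_comp; first exact: fc.
  by apply: gc; rewrite inE; apply: fUV; rewrite inE in Ux.
- move=> x h Ux; eexists; apply: (is_dderiv_comp oV (fUV x Ux) gC1).
  exact: dderivableP (fd x h Ux).
- pose Tf (z : X * X) := (f z.1, dderiv f z.1 z.2).
  have oUT := @open_prodT _ X _ oU.
  have ffst : Cn_on k (U `*` [set: X]) (f \o fst).
    apply: IH (Cn_on_pred fC) _ => //; first exact: prod_hausdorff.
      by move=> z [].
    by apply: Cn_on_lin => // z; exact: cvg_fst.
  have TfC : Cn_on k (U `*` [set: X]) Tf by exact: Cn_on_pair ffst df.
  have := IH _ _ _ (U `*` [set: X]) (V `*` [set: Y]) _ Tf _ _ _ _ _ _ dg TfC.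
  move=> /(_ (prod_hausdorff hX hX) (prod_hausdorff hY hY) hZ oUT (@open_prodT _ Y _ oV)).
  have TfUV : set_fun (U `*` [set: X]) (V `*` [set: Y]) Tf.
    by move=> z [Uz _]; split => //; exact: fUV.
  move=> /(_ TfUV); apply: eq_Cn_on => // -[x h]; rewrite inE => -[/= Ux _].
  apply/esym/is_dderivE => //; apply: (is_dderiv_comp oV (fUV x Ux) gC1).
  exact: dderivableP (fd x h Ux).
Qed.

Lemma smooth_on_subset X Y (U V : set X) (f : X -> Y) :
  V `<=` U -> smooth_on U f -> smooth_on V f.
Proof. by move=> VU fC k; exact: Cn_on_subset (fC k). Qed.

Lemma eq_smooth_on X Y (U : set X) (f g : X -> Y) : open U ->
  {in U, f =1 g} -> smooth_on U f -> smooth_on U g.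
Proof. by move=> oU fg fC k; exact: eq_Cn_on (fC k). Qed.

Lemma smooth_on_comp X Y Z (U : set X) (V : set Y) (g : Y -> Z) (f : X -> Y) :
  hausdorff_space X -> hausdorff_space Y -> hausdorff_space Z ->
  open U -> open V -> set_fun U V f ->
  smooth_on V g -> smooth_on U f -> smooth_on U (g \o f).
Proof.
move=> hX hY hZ oU oV fUV gC fC k.
exact: (Cn_on_comp hX hY hZ oU oV fUV (gC k) (fC k)).
Qed.

Lemma smooth_on_lin X Y (U : set X) (f : X -> Y) : hausdorff_space Y ->
  linear f -> continuous f -> smooth_on U f.
Proof. by move=> *; move=> k; exact: Cn_on_lin. Qed.

Lemma smooth_on_cst X Y (U : set X) (c : Y) : hausdorff_space Y ->
  smooth_on U (fun=> c).
Proof. by move=> *; move=> k; exact: Cn_on_cst. Qed.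

Lemma smooth_onD X Y (U : set X) (f g : X -> Y) : hausdorff_space X ->
  hausdorff_space Y -> open U ->
  smooth_on U f -> smooth_on U g -> smooth_on U (fun x => f x + g x).
Proof.
move=> hX hY oU fC gC.
have hYY := prod_hausdorff hY hY.
have pC : smooth_on U (fun x => (f x, g x)) by move=> k; apply: Cn_on_pair.
have aC : smooth_on setT (fun z : Y * Y => z.1 + z.2).
  apply: smooth_on_lin => //; last exact: add_continuous.
  by move=> a u v /=; rewrite scalerDr addrACA.
exact: (smooth_on_comp hX hYY hY oU openT _ aC pC).
Qed.

Lemma smooth_onB X Y (U : set X) (f g : X -> Y) : hausdorff_space X ->
  hausdorff_space Y -> open U ->
  smooth_on U f -> smooth_on U g -> smooth_on U (fun x => f x - g x).
Proof.
move=> hX hY oU fC gC; apply: smooth_onD => //.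
have oC : smooth_on setT (fun y : Y => - y).
  apply: smooth_on_lin => //; last exact: opp_continuous.
  by move=> a u v /=; rewrite opprD scalerN.
exact: (smooth_on_comp hX hY hY oU openT _ oC gC).
Qed.

Lemma smooth_on_Cn1 X Y (U : set X) (f : X -> Y) : smooth_on U f -> Cn_on 1 U f.
Proof. exact. Qed.

Lemma smooth_on_dderiv X Y (U : set X) (f : X -> Y) : smooth_on U f ->
  smooth_on (U `*` [set: X]) (fun z : X * X => dderiv f z.1 z.2).
Proof. by move=> fC k; have [] := fC k.+1. Qed.

End Cn_calculus.

(** * The inverse function theorem *)

Section normed_estimates.
Context {R : realType}.
Implicit Types (X : tvsType R) (E F : normedModType R).

Lemma is_dderivB X (Y : tvsType R) (f g : X -> Y) x h y z :
  is_dderiv f x h y -> is_dderiv g x h z ->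
  is_dderiv (fun x => f x - g x) x h (y - z).
Proof.
move=> fy gz; rewrite /is_dderiv; apply: near_eq_cvg_to (tvs_cvgB fy gz).
by apply: nearW => t; rewrite -scalerBr !opprD !opprK addrACA.
Qed.

Lemma is_dderiv_segment X (Y : tvsType R) (f : X -> Y) a h (s : R) v :
  is_dderiv f (s *: h + a) h v ->
  is_dderiv (fun t : R^o => f (t *: h + a)) s 1 v.
Proof.
rewrite /is_dderiv; apply: near_eq_cvg_to; apply: nearW => t.
by rewrite addrA -scalerDl -[t *: (1 : R^o)]/(t * 1) mulr1.
Qed.

(** [mean_value_convex] for the open ball of radius [C + e]; the slack [e] turns the weak bound into
    membership in an open set. *)
Lemma norm_mean_value X F (f : X -> F) a b (C : R) :
  (forall s : R, 0 <= s <= 1 ->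
    exists2 v, `|v| <= C & is_dderiv f (s *: (b - a) + a) (b - a) v) ->
  `|f b - f a| <= C.
Proof.
move=> fC; apply/ler_addgt0Pr => e e0; apply: ltW.
pose g (t : R^o) := f (t *: (b - a) + a).
have -> : f b - f a = g 1 - g 0 by rewrite /g scale1r scale0r add0r subrK.
apply: (@mean_value_convex _ _ g [set v | `|v| < C + e]).
- rewrite (_ : [set _ | _] = ball (0 : F) (C + e)); first exact: ball_open.
  by rewrite -ball_normE; apply/seteqP; split=> v /=; rewrite sub0r normrN.
- move=> s u v /andP[s0 s1] /= uC vC.
  have [->|sn0] := eqVneq s 0; first by rewrite scale0r add0r subr0 scale1r.
  have -> : C + e = s * (C + e) + (1 - s) * (C + e).
    by rewrite -mulrDl [s + _]addrC subrK mul1r.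
  apply: le_lt_trans (ler_normD _ _) _; rewrite !normrZ.
  rewrite (ger0_norm s0) (@ger0_norm _ (1 - s)) ?subr_ge0 //.
  apply: ltr_leD; first by rewrite ltr_pM2l // lt_neqAle eq_sym sn0.
  by rewrite ler_wpM2l ?subr_ge0 // ltW.
- move=> s /fC[v vC fv]; exists v; last exact: is_dderiv_segment fv.
  by rewrite /= (le_lt_trans vC) // ltrDl.
Qed.

(** Rescaling [k] to norm [d / 2] brings it into the ball where the bound is given. *)
Lemma homogeneous_bound E F (N : E -> F) (d C : R) : 0 < d ->
  (forall a k, N (a *: k) = a *: N k) -> (forall k, `|k| < d -> `|N k| <= C) ->
  forall k, `|N k| <= (2 * C / d) * `|k|.
Proof.
move=> d0 hN NC k; have [->|k0] := eqVneq k 0.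
  by rewrite -{1}(scale0r 0) hN scale0r !normr0 mulr0.
have nk0 : 0 < `|k| by rewrite normr_gt0.
pose a := d / (2 * `|k|).
have a0 : 0 < a by rewrite divr_gt0 // mulr_gt0.
have := NC (a *: k); rewrite hN !(normrZ a) (gtr0_norm a0).
have -> : a * `|k| = d / 2 by rewrite /a; field; rewrite gt_eqF.
rewrite ltr_pdivrMr // ltr_pMr // ltr1n => /(_ isT).
rewrite -ler_pdivlMl // => /le_trans; apply.
by rewrite /a le_eqVlt; apply/orP; left; apply/eqP; field; rewrite !gt_eqF.
Qed.

Lemma nbhs_norm_lt E (x : E) (A : set E) :
  nbhs x A -> exists2 d : R, 0 < d & forall y, `|y - x| < d -> A y.
Proof.
move=> /nbhs_normP[d /= d0 dA]; exists d => // y yx; apply: dA.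
by rewrite /= distrC.
Qed.

Lemma nbhs_pairP E F (x : E) (h : F) (A : set (E * F)) :
  nbhs (x, h) A -> exists2 d : R, 0 < d &
    forall y k, `|y - x| < d -> `|k - h| < d -> A (y, k).
Proof.
move=> [[B C] /= [/nbhs_norm_lt[d d0 dB] /nbhs_norm_lt[e e0 eC]] BC].
exists (Num.min d e); first by rewrite lt_min d0.
by move=> y k; rewrite !lt_min => /andP[/dB By _] /andP[_ /eC Ck]; exact: (BC (y, k)).
Qed.

Lemma dderiv0 X F (f : X -> F) x : dderiv f x 0 = 0.
Proof.
apply: is_dderivE; first exact: norm_hausdorff.
rewrite /is_dderiv; apply: near_eq_cvg_to (cvg_cst (0 : F)).
by apply: nearW => t; rewrite scaler0 add0r subrr scaler0.
Qed.

(* Continuity of the second derivative at [((x0, 0), (0, 0))] bounds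
   it there; homogeneity in both increments turns this into an estimate in
   operator norm. *)
Lemma dderiv_norm_continuous E F (U : set E) (f : E -> F) (x0 : E) (e : R) :
  open U -> U x0 -> Cn_on 2 U f -> 0 < e ->
  exists2 d : R, 0 < d & forall x, `|x - x0| < d ->
    U x /\ forall h, `|dderiv f x h - dderiv f x0 h| <= e * `|h|.
Proof.
move=> oU Ux0 [_ fd [_ Gd dGc]] e0; pose G (z : E * E) := dderiv f z.1 z.2.
have hF : hausdorff_space F by exact: norm_hausdorff.
have z0 : ((x0, 0), (0, 0)) \in (U `*` [set: E]) `*` [set: E * E] by rewrite inE.
have := dGc _ z0; rewrite /continuous_at /= dderiv0 => dG0.
have := dG0 _ (nbhsx_ballx 0 1 ltr01).
move=> /nbhs_pairP[d d0 dG1].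
have [d' d'0 d'U] := nbhs_norm_lt (open_nbhs_nbhs (conj oU Ux0)).
pose r := Num.min d d'.
have r0 : 0 < r by rewrite lt_min d0.
have bound x h k : `|x - x0| < r -> `|h| < r -> `|k| < r ->
    `|dderiv G (x, h) (k, 0)| <= 1.
  rewrite !lt_min => /andP[xd xd'] /andP[hd _] /andP[kd _].
  have := dG1 (x, h) (k, 0); rewrite /= -ball_normE /= sub0r normrN => H.
  apply/ltW/H; rewrite [`|_|]prod_normE /= ?subr0 ?normr0 gt_max ?xd ?hd ?kd //.
(* [eta <= 1] keeps the ball of radius [eta * r] inside that of radius [r], and [eta <= e * r / 2]
   makes the final constant [2 * eta / r] at most [e]. *)
pose eta := Num.min 1 (e * r / 2).
have eta0 : 0 < eta by rewrite lt_min ltr01 divr_gt0 // mulr_gt0.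
exists (eta * r); first exact: mulr_gt0.
move=> x xx0.
have eta1 : eta <= 1 by rewrite /eta ge_min lexx.
have xr : `|x - x0| < r by apply: lt_le_trans xx0 _; rewrite ler_piMl // ltW.
have Ux : U x by apply: d'U; move: xr; rewrite lt_min => /andP[].
split => // h.
have : `|dderiv f x h - dderiv f x0 h| <= 2 * eta / r * `|h|.
  move: h; apply: homogeneous_bound => //.
    by move=> a k; rewrite !dderivZ // ?scalerBr //; exact: fd.
  move=> h hr.
  apply: (@norm_mean_value E F (fun y => dderiv f y h)) => s /andP[s0 s1].
  set p := s *: (x - x0) + x0.
  have px : `|p - x0| < r.
    rewrite /p addrK normrZ ger0_norm //; apply: le_lt_trans xr.
    by rewrite ler_piMl.
  have Up : U p by apply: d'U; move: px; rewrite lt_min => /andP[].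
  have Upp : (U `*` [set: E]) (p, h) by split.
  exists (dderiv G (p, h) (x - x0, 0)).
    (* [x - x0] is [eta] times a vector of norm below [r], so the second derivative in that
       direction has norm at most [eta]. *)
    pose k := eta^-1 *: (x - x0).
    have -> : (x - x0, 0) = eta *: (k, 0 : E).
      by rewrite /k; congr pair; rewrite ?scaler0 //= scalerA divff ?scale1r // gt_eqF.
    rewrite dderivZ //; last exact: Gd.
    rewrite normrZ gtr0_norm // ler_piMr ?(ltW eta0) //; apply: bound => //.
    rewrite /k normrZ gtr0_norm ?invr_gt0 // mulrC ltr_pdivrMr //.
    by rewrite mulrC.
  have := dderivableP (Gd (p, h) (x - x0, 0) Upp).
  rewrite /is_dderiv; apply: near_eq_cvg_to; apply: nearW => t.
  by rewrite /G /= scaler0 add0r.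
move/le_trans; apply; rewrite ler_wpM2r // ler_pdivrMr //.
by rewrite mulrC -ler_pdivlMr // /eta ge_min lexx orbT.
Qed.

(** The mean value theorem for [f - dderiv f x0], whose derivative is small in operator norm near
    [x0]. Order two is assumed because joint continuity of the first derivative does not give
    continuity in operator norm. *)
Lemma strict_frechet E F (U : set E) (f : E -> F) (x0 : E) (e : R) :
  open U -> U x0 -> Cn_on 2 U f -> 0 < e ->
  exists2 d : R, 0 < d & forall u v, `|u - x0| < d -> `|v - x0| < d ->
    `|f u - f v - dderiv f x0 (u - v)| <= e * `|u - v|.
Proof.
move=> oU Ux0 fC e0.
have [d d0 dU] := dderiv_norm_continuous oU Ux0 fC e0; exists d => // u v ud vd.
have hF : hausdorff_space F by exact: norm_hausdorff.
have fC1 : Cn_on 1 U f := Cn_on_le (isT : (1 <= 2)%N) fC.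
have [_ fd _] := fC1.
have lf := Cn1_dderiv_linear hF oU fC1 Ux0.
have -> : f u - f v - dderiv f x0 (u - v) =
    (f u - dderiv f x0 u) - (f v - dderiv f x0 v).
  by rewrite linB // !opprD !opprK addrACA.
apply: (@norm_mean_value E F (fun y => f y - dderiv f x0 y)) => s /andP[s0 s1].
set p := s *: (u - v) + v.
have pd : `|p - x0| < d.
  have -> : p - x0 = s *: (u - x0) + (1 - s) *: (v - x0).
    have uv : u - v = (u - x0) - (v - x0) by rewrite opprB addrA subrK.
    rewrite /p uv -addrA scalerBr scalerBl scale1r -addrA; congr (_ + _).
    by rewrite addrC.
  rewrite (le_lt_trans (ler_normD _ _)) // !normrZ (ger0_norm s0).
  rewrite (@ger0_norm _ (1 - s)) ?subr_ge0 //.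
  have -> : d = s * d + (1 - s) * d by rewrite -mulrDl [s + _]addrC subrK mul1r.
  have [->|sn0] := eqVneq s 0; first by rewrite !mul0r !add0r subr0 !mul1r.
  apply: ltr_leD; first by rewrite ltr_pM2l // lt_neqAle eq_sym sn0.
  by rewrite ler_wpM2l ?subr_ge0 // ltW.
have [Up dp] := dU p pd.
exists (dderiv f p (u - v) - dderiv f x0 (u - v)); first exact: dp.
by apply: is_dderivB; [exact: dderivableP (fd _ _ Up)|exact: is_dderiv_linear].
Qed.

End normed_estimates.

(** * Smoothness of the inverse map *)

Section inverse_smooth.
Context {R : realType}.
Implicit Types (E F : normedModType R).

(* The displacement [u] of the inverse satisfies [t k = dphi(x) u + o(u)];
   applying the bounded inverse [D y] of [dphi(x)] gives [u = O(t)] and then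
   [u = t D(y, k) + o(t)]. *)
Lemma is_dderiv_inverse E F (U : set E) (V : set F) (phi : E -> F) (psi : F -> E)
    (D : F -> E) (y k : F) :
  open U -> open V -> V y -> Cn_on 2 U phi -> set_fun V U psi ->
  {in V, cancel psi phi} -> psi z @[z --> y] --> psi y ->
  linear D -> continuous D -> (forall h, D (dderiv phi (psi y) h) = h) ->
  is_dderiv psi y k (D k).
Proof.
move=> oU oV Vy phiC psiVU psiK psic lD Dc DK.
have Ux : U (psi y) by exact: psiVU.
have [r r0 Dr] := nbhs_norm_lt (Dc 0 _ (nbhsx_ballx (D 0) 1 ltr01)).
have D1 k' : `|k'| < r -> `|D k'| <= 1.
  move=> kr; have := Dr k'; rewrite subr0 => /(_ kr).
  by rewrite lin0 // -ball_normE /= sub0r normrN => /ltW.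
have DC k' : `|D k'| <= 2 * 1 / r * `|k'|.
  by apply: homogeneous_bound D1 _ => // a v; exact: linZ.
set C := 2 * 1 / r in DC.
have C0 : 0 < C by rewrite /C mulr1 divr_gt0.
pose u (t : R) := psi (t *: k + y) - psi y.
(* Strict differentiability of [phi] between [psi (t *: k + y)] and [psi y], transported by the
   bounded map [D]. *)
have est e : 0 < e -> \forall t \near (0 : R)^', `|D (t *: k) - u t| <= C * e * `|u t|.
  move=> e0; have [d d0 dphi] := strict_frechet oU Ux phiC e0.
  have psid : \forall t \near (0 : R)^', `|psi (t *: k + y) - psi y| < d.
    have : (psi (t *: k + y)) @[t --> (0 : R)^'] --> psi y.
      apply: (@cvg_comp _ _ _ (fun t : R => t *: k + y) psi _ (nbhs y)) => //.
      exact: line_cvg.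
    move=> /cvgrPdist_lt /(_ d d0); apply: filterS => t; by rewrite distrC.
  have Vt : \forall t \near (0 : R)^', V (t *: k + y).
    exact: (line_cvg k (open_nbhs_nbhs (conj oV Vy))).
  apply: filterS2 psid Vt => t ut Vt.
  have := dphi (psi (t *: k + y)) (psi y) ut.
  rewrite subrr normr0 => /(_ d0); rewrite !psiK ?inE // addrK -/(u t).
  move=> /(ler_wpM2l (ltW C0)); rewrite mulrA; apply: le_trans.
  have -> : D (t *: k) - u t = D (t *: k - dderiv phi (psi y) (u t)).
    by rewrite (linB _ _ lD) DK.
  exact: DC.
have uO : \forall t \near (0 : R)^', `|u t| <= 2 * `|D k| * `|t|.
  (* With this constant the error is at most half the norm of [u t] and is absorbed on the left. *)
  have e0 : 0 < (2 * C)^-1 by rewrite invr_gt0 mulr_gt0.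
  apply: filterS (est _ e0) => t; rewrite linZ //.
  have -> : C * (2 * C)^-1 = 2^-1 by field; rewrite gt_eqF.
  move=> h; have : `|u t| <= `|t *: D k| + 2^-1 * `|u t|.
    apply: le_trans (_ : _ <= `|t *: D k| + `|t *: D k - u t|) _; last by rewrite lerD2l.
    by have := ler_normB (t *: D k) (t *: D k - u t); rewrite opprB addrC subrK.
  rewrite normrZ; lra.
rewrite /is_dderiv; apply/cvgrPdist_le => e e0.
(* [c] compensates the bound [C] on [D] and the bound from [uO]; the [+ 1] keeps it positive when
   [D k = 0]. *)
pose c := C * (2 * `|D k| + 1).
have c0 : 0 < c by rewrite /c mulr_gt0 // ltr_wpDl // mulr_ge0.
have tn0 : \forall t \near (0 : R)^', t != 0 by exact: nbhs_dnbhs_neq.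
have ec0 : 0 < e / c by rewrite divr_gt0.
apply: filterS3 tn0 uO (est _ ec0) => t t0 utO; rewrite linZ // -/(u t) => h.
have tp : 0 < `|t| by rewrite normr_gt0.
have -> : D k - t^-1 *: u t = t^-1 *: (t *: D k - u t) by rewrite [RHS]scalerBr scalerK.
rewrite normrZ normfV mulrC ler_pdivrMr //; apply: le_trans h _.
have -> : C * (e / c) = e / (2 * `|D k| + 1).
  rewrite /c; field; rewrite gt_eqF //= gt_eqF // ltr_wpDl // mulr_ge0 //.
rewrite -mulrA ler_wpM2l ?(ltW e0) // mulrC ler_pdivrMr ?ltr_wpDl ?mulr_ge0 //.
by apply: le_trans utO _; rewrite mulrC ler_wpM2l // lerDl.
Qed.

Definition tangent_lift {X Y : tvsType R} (f : X -> Y) (z : X * X) : Y * Y :=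
  (f z.1, dderiv f z.1 z.2).

Lemma smooth_tangent_lift (X Y : tvsType R) (U : set X) (f : X -> Y) :
  hausdorff_space X -> hausdorff_space Y -> open U -> smooth_on U f ->
  smooth_on (U `*` [set: X]) (tangent_lift f).
Proof.
move=> hX hY oU fC k; apply: Cn_on_pair => //.
- exact: open_prodT.
- apply: (@Cn_on_comp _ _ _ _ _ _ U f fst) => //.
  + exact: prod_hausdorff.
  + exact: open_prodT.
  + by move=> z [].
  + by apply: Cn_on_lin => // z; exact: cvg_fst.
- exact: smooth_on_dderiv.
Qed.

(** Split [(u, v)] as [(u, 0) + (0, v)]; the second part is evaluated by linearity of [dderiv f x].
    The result is triangular in [(u, v)], which lets [Cn_on_inverse] invert it one component at a
    time. *)
Lemma dderiv_tangent_lift (X Y : tvsType R) (U : set X) (f : X -> Y) x h u v :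
  hausdorff_space X -> hausdorff_space Y -> open U -> smooth_on U f -> U x ->
  dderiv (tangent_lift f) (x, h) (u, v) =
  (dderiv f x u,
   dderiv (fun z : X * X => dderiv f z.1 z.2) (x, h) (u, 0) + dderiv f x v).
Proof.
move=> hX hY oU fC Ux; pose G (z : X * X) := dderiv f z.1 z.2.
have oUT := @open_prodT _ X _ oU.
have GC1 : Cn_on 1 (U `*` [set: X]) G := smooth_on_dderiv fC 1%N.
have fC1 := smooth_on_Cn1 fC.
have [_ fd _] := fC1; have [_ Gd _] := GC1.
have Uxh : (U `*` [set: X]) (x, h) by split.
have lG := Cn1_dderiv_linear hY oUT GC1 Uxh.
have lf := Cn1_dderiv_linear hY oU fC1 Ux.
have Gv : is_dderiv G (x, h) (0, v) (dderiv f x v).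
  have := @is_dderiv_linear _ _ _ _ h v lf.
  rewrite /is_dderiv; apply: near_eq_cvg_to; apply: nearW => t.
  by rewrite /G /= scaler0 add0r.
apply: is_dderivE; first exact: prod_hausdorff.
apply: is_dderiv_pair.
  have := dderivableP (fd x u Ux); rewrite /is_dderiv; apply: near_eq_cvg_to.
  exact: nearW.
have -> : (u, v) = (u, 0) + (0, v) :> X * X by congr pair; rewrite /= ?addr0 ?add0r.
rewrite -(is_dderivE hY Gv) -/G -(linD _ _ lG).
exact: dderivableP (Gd _ _ Uxh).
Qed.

(* The tangent lift of a diffeomorphism is again a diffeomorphism, with inverse
   [(y, k) |-> (psi y, D y k)], and [D] is the derivative of [psi]; hence the
   induction on the order of differentiability. *)
Lemma Cn_on_inverse E F n (U : set E) (V : set F) (phi : E -> F) (psi : F -> E)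
    (D : F -> F -> E) :
  open U -> open V -> smooth_on U phi -> set_fun V U psi ->
  {in V, cancel psi phi} -> {in V, continuous psi} ->
  {in V `*` [set: F], continuous (fun z : F * F => D z.1 z.2)} ->
  (forall y h, V y -> D y (dderiv phi (psi y) h) = h) ->
  (forall y k, V y -> dderiv phi (psi y) (D y k) = k) ->
  Cn_on n V psi.
Proof.
elim: n E F U V phi psi D => [|n IH] E F U V phi psi D oU oV phiC psiVU psiK psic Dc DK KD //.
have hE : hausdorff_space E by exact: norm_hausdorff.
have hF : hausdorff_space F by exact: norm_hausdorff.
have lphi y : V y -> linear (dderiv phi (psi y)).
  by move=> Vy; apply: (Cn1_dderiv_linear hF oU (smooth_on_Cn1 phiC)); exact: psiVU.
have lD y : V y -> linear (D y).
  move=> Vy a u v; rewrite -{1}(KD y u Vy) -{1}(KD y v Vy).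
  by rewrite -(lphi y Vy) DK.
have D1c y : V y -> continuous (D y).
  move=> Vy k; have Vyk : (y, k) \in V `*` [set: F] by rewrite inE.
  have yk : (y, k') @[k' --> k] --> (y, k).
    by apply: cvg_to_pair; [exact: cvg_cst|exact: cvg_id].
  exact: (cvg_comp _ _ yk (Dc _ Vyk)).
have dpsi y k : V y -> is_dderiv psi y k (D y k).
  move=> Vy; apply: (is_dderiv_inverse oU oV Vy (phiC 2%N) psiVU psiK) => //.
  - by apply: psic; rewrite inE.
  - exact: lD.
  - exact: D1c.
  - by move=> h; exact: DK.
split => //; first by move=> y k Vy; exists (D y k); exact: dpsi.
have oVT := @open_prodT _ F _ oV.
have oUT := @open_prodT _ E _ oU.
pose Tpsi (z : F * F) := (psi z.1, D z.1 z.2).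
pose G (z : E * E) := dderiv phi z.1 z.2.
(* [D'] inverts the triangular derivative of [tangent_lift phi] by substitution: first [D z.1 w.1],
   then the mixed second-order term is subtracted. *)
pose D' (z w : F * F) := (D z.1 w.1, D z.1 (w.2 - dderiv G (Tpsi z) (D z.1 w.1, 0))).
(* The derivative of [psi] is the second component of [Tpsi], to which the induction hypothesis
   applies as the inverse of [tangent_lift phi]. *)
suff TpsiC : Cn_on n (V `*` [set: F]) Tpsi.
  have sndC : Cn_on n setT (snd : E * E -> E).
    by apply: Cn_on_lin => // z; exact: cvg_snd.
  have := @Cn_on_comp _ _ _ _ n _ _ _ _ (prod_hausdorff hF hF) (prod_hausdorff hE hE) hE
    oVT openT (fun _ _ => I) sndC TpsiC.
  apply: eq_Cn_on => // -[y k]; rewrite inE => -[/= Vy _].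
  by apply/esym/is_dderivE => //; exact: dpsi.
apply: (IH _ _ (U `*` [set: E]) (V `*` [set: F]) (tangent_lift phi) Tpsi D') => //.
- exact: smooth_tangent_lift.
- by move=> z [Vz _]; split => //; exact: psiVU.
- move=> [y k]; rewrite inE => -[/= Vy _]; rewrite /tangent_lift /Tpsi /=.
  by rewrite psiK ?inE // KD.
- move=> [y k]; rewrite inE => -[/= Vy _]; apply: cvg_to_pair.
    apply: continuous_comp; first exact: cvg_fst.
    by apply: psic; rewrite inE.
  by apply: Dc; rewrite inE.
- move=> [[y k] [u v]]; rewrite inE => -[[/= Vy _] _].
  set p := (_, _).
  have a : z.1 @[z --> p] --> (y, k) by exact: cvg_fst.
  have b : z.2 @[z --> p] --> (u, v) by exact: cvg_snd.
  have a1 : z.1.1 @[z --> p] --> y by exact: (cvg_comp _ _ a cvg_fst).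
  have b1 : z.2.1 @[z --> p] --> u by exact: (cvg_comp _ _ b cvg_fst).
  have b2 : z.2.2 @[z --> p] --> v by exact: (cvg_comp _ _ b cvg_snd).
  have cD (f : (F * F) * (F * F) -> F) l : f z @[z --> p] --> l ->
      D z.1.1 (f z) @[z --> p] --> D y l.
    move=> fl; have Vyl : (y, l) \in V `*` [set: F] by rewrite inE.
    exact: (cvg_comp _ _ (cvg_to_pair a1 fl) (Dc _ Vyl)).
  have cT : Tpsi z.1 @[z --> p] --> Tpsi (y, k).
    apply: cvg_to_pair; last first.
      have Vyk : (y, k) \in V `*` [set: F] by rewrite inE.
      exact: (cvg_comp _ _ a (Dc _ Vyk)).
    by apply: (cvg_comp _ _ a1); apply: psic; rewrite inE.
  have [_ _ dGc] := smooth_on_dderiv phiC 1%N.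
  have cw : (D z.1.1 z.2.1, 0 : E) @[z --> p] --> (D y u, 0 : E).
    by apply: cvg_to_pair; [exact: cD|exact: cvg_cst].
  have cG : dderiv G (Tpsi z.1) (D z.1.1 z.2.1, 0) @[z --> p] -->
      dderiv G (Tpsi (y, k)) (D y u, 0).
    have Gp : (Tpsi (y, k), (D y u, 0)) \in (U `*` [set: E]) `*` [set: E * E].
      by rewrite inE; split => //; split => //; exact: psiVU.
    exact: (cvg_comp _ _ (cvg_to_pair cT cw) (dGc _ Gp)).
  by apply: cvg_to_pair; apply: cD => //; exact: tvs_cvgB.
- move=> [y k] [u v] [/= Vy _].
  rewrite /Tpsi /D' (dderiv_tangent_lift (U := U)) //=; last exact: psiVU.
  by rewrite DK // addrC addKr DK.
- move=> [y k] [u v] [/= Vy _].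
  rewrite /Tpsi /D' (dderiv_tangent_lift (U := U)) //=; last exact: psiVU.
  by rewrite !KD // addrC subrK.
Qed.

End inverse_smooth.

(** * Local inverses by contraction *)

Section inverse_function.
Context {R : realType}.

(** A solution is a fixed point of [fun x => y - r x], a contraction of the closed ball of radius
    [d]: its values there have norm at most [d / 2 + d / 2]. Completeness of [E] enters through the
    Banach fixed point theorem. *)
Lemma perturbed_identity_surjective (E : completeNormedModType R) (r : E -> E) (d : R) (y : E) :
  (forall u v, `|u| <= d -> `|v| <= d -> `|r u - r v| <= 2^-1 * `|u - v|) ->
  r 0 = 0 -> `|y| <= d / 2 -> exists2 x, `|x| <= d & x + r x = y.
Proof.
move=> rlip r0 yd; have d0 : 0 <= d by have := normr_ge0 y; lra.
pose B : set E := [set x | `|x| <= d].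
have B0 : B 0 by rewrite /B /= normr0.
have TB : {homo (fun x => y - r x) : x / B x >-> B x}.
  move=> x Bx; rewrite /B /=; apply: le_trans (ler_normB _ _) _.
  by have := rlip x 0 Bx B0; rewrite r0 !subr0; have : `|x| <= d by []; lra.
have clB : closed B.
  have -> : B = closed_ball_ Num.norm (0 : E) d.
    by apply/seteqP; split=> x; rewrite /B /closed_ball_ /= sub0r normrN.
  exact: closed_closed_ball_.
have ctr : is_contraction (mkfun_fun TB).
  have q0 : (0 : R) <= 2^-1 by [].
  exists (NngNum q0); split => /=; first by lra.
  move=> [u v] [Bu Bv] /=.
  have -> : y - r u - (y - r v) = r v - r u by rewrite opprB addrC addrA subrK.
  by rewrite distrC; exact: rlip.
have [x Bx xE] := banach_fixed_point ctr clB (ex_intro _ 0 B0).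
by exists x => //; rewrite {1}xE /= subrK.
Qed.

(** Near 0 both [f - id] and each [dderiv f x - id] are Lipschitz with constant [2^-1]. The first
    fact gives the local inverse, the second inverts the derivatives. *)
Theorem inverse_function (E : completeNormedModType R) (U : set E) (f : E -> E) :
  open U -> U 0 -> smooth_on U f -> f 0 = 0 -> (forall h, dderiv f 0 h = h) ->
  exists A B (g : E -> E), [/\ open A, open B, A 0 & A `<=` U] /\
    [/\ set_fun A B f, set_fun B A g, {in A, cancel f g}, {in B, cancel g f}
      & smooth_on B g].
Proof.
move=> oU U0 fC f0 df0.
have h2 : 0 < 2^-1 :> R by [].
have [d1 d10 fd1] := strict_frechet oU U0 (fC 2%N) h2.
have [d2 d20 fd2] := dderiv_norm_continuous oU U0 (fC 2%N) h2.
(* Halving puts the closed ball of radius [d] inside both open balls. *)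
pose d := Num.min d1 d2 / 2.
have m0 : 0 < Num.min d1 d2 by rewrite lt_min d10.
have d0 : 0 < d by rewrite divr_gt0.
have dm : d < Num.min d1 d2 by rewrite ltr_pdivrMr // ltr_pMr // ltr1n.
have [dd1 dd2] : d < d1 /\ d < d2 by move: dm; rewrite lt_min => /andP.
have rlip u v : `|u| <= d -> `|v| <= d -> `|f u - u - (f v - v)| <= 2^-1 * `|u - v|.
  move=> ud vd; have := fd1 u v; rewrite !subr0 df0.
  move=> /(_ (le_lt_trans ud dd1) (le_lt_trans vd dd1)).
  by rewrite !opprD !opprK addrACA.
have dU x : `|x| <= d -> U x /\ forall h, `|dderiv f x h - h| <= 2^-1 * `|h|.
  move=> xd; have := fd2 x; rewrite subr0 => /(_ (le_lt_trans xd dd2)) [Ux H].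
  by split => // h; have := H h; rewrite df0.
have finj u v : `|u| <= d -> `|v| <= d -> `|u - v| <= 2 * `|f u - f v|.
  move=> ud vd; have := rlip u v ud vd.
  have e : f u - u - (f v - v) = f u - f v - (u - v) by rewrite !opprD !opprK addrACA.
  have := ler_normB (f u - f v) (f u - u - (f v - v)).
  by rewrite {1}e subKr; lra.
pose B : set E := ball 0 (d / 2).
have BE y : B y = (`|y| < d / 2) by rewrite /B -ball_normE /= sub0r normrN.
have d20' : 0 < d / 2 by rewrite divr_gt0.
have oball (e : R) : open (ball (0 : E) e) by exact: ball_open.
have oB : open B by exact: oball.
pose W : set E := ball 0 d.
have WE x : W x = (`|x| < d) by rewrite /W -ball_normE /= sub0r normrN.
have WU : W `<=` U by move=> x; rewrite WE => /ltW /dU[].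
pose g y := xget 0 [set x | `|x| <= d /\ f x = y].
(* The fixed point is only known to lie in the closed ball; [finj] against 0 bounds its norm by
   twice that of [y], which is below [d]. *)
have gP y : B y -> W (g y) /\ f (g y) = y.
  rewrite BE => yd.
  have [|x xd xE] := perturbed_identity_surjective (r := fun x => f x - x) rlip _ (ltW yd).
    by rewrite f0 subr0.
  have [] : [set x | `|x| <= d /\ f x = y] (g y).
    by apply: (@xgetPex _ 0); exists x; split => //; rewrite -xE addrC subrK.
  move=> gd fg; split => //; rewrite WE.
  have := finj (g y) 0 gd; rewrite normr0 f0 !subr0 fg => /(_ (ltW d0)); lra.
have fK x : W x -> B (f x) -> g (f x) = x.
  move=> Wx Bfx; have [Wg fg] := gP _ Bfx.
  have := finj (g (f x)) x; rewrite fg subrr normr0 mulr0.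
  move: Wg Wx; rewrite !WE => /ltW Wg /ltW Wx /(_ Wg Wx).
  by rewrite normr_le0 subr_eq0 => /eqP.
have glip y y' : B y -> B y' -> `|g y - g y'| <= 2 * `|y - y'|.
  move=> /gP[Wy fy] /gP[Wy' fy']; rewrite -{2}fy -{2}fy'.
  by move: Wy Wy'; rewrite !WE => /ltW ? /ltW ?; exact: finj.
have nearB y : B y -> \forall y' \near y, B y' by move=> By; exact: open_nbhs_nbhs.
have gc : {in B, continuous g}.
  move=> y; rewrite inE => By; apply/cvgrPdist_lt => e e0.
  have e20 : 0 < e / 2 by rewrite divr_gt0.
  have near_y : \forall y' \near y, `|y - y'| < e / 2.
    by apply: cvgr_dist_lt => //; exact: cvg_id.
  apply: filterS2 near_y (nearB y By) => y' yy' By'.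
  by apply: le_lt_trans (glip _ _ By By') _; lra.
pose D y k := xget 0 [set h | dderiv f (g y) h = k].
have fC1 := smooth_on_Cn1 fC; have [fc fd fdc] := fC1.
have hE : hausdorff_space E by exact: norm_hausdorff.
have Ug y : B y -> U (g y) by move=> /gP[/WU].
have ldf y : B y -> linear (dderiv f (g y)).
  by move=> By; apply: (Cn1_dderiv_linear hE oU fC1); exact: Ug.
have dfB y h : B y -> `|dderiv f (g y) h - h| <= 2^-1 * `|h|.
  by move=> /gP[]; rewrite WE => /ltW /dU [_ H] _; exact: H.
have dfinj y h : B y -> `|h| <= 2 * `|dderiv f (g y) h|.
  move=> By; have := dfB y h By.
  by have := ler_normB (dderiv f (g y) h) (dderiv f (g y) h - h); rewrite subKr; lra.
(* Surjectivity of the derivative follows from the same contraction, now on the ball whose radius is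
   twice the norm of [k]. *)
have KD y k : B y -> dderiv f (g y) (D y k) = k.
  move=> By; have lf := ldf y By.
  have [h _ hE'] : exists2 h, `|h| <= 2 * `|k| & h + (dderiv f (g y) h - h) = k.
    apply: (perturbed_identity_surjective (r := fun h => dderiv f (g y) h - h)).
  - move=> u v _ _; rewrite (_ : _ - _ = dderiv f (g y) (u - v) - (u - v)); first exact: dfB.
    by rewrite (linB _ _ lf) !opprD !opprK addrACA.
  - by rewrite (lin0 lf) subr0.
  - by rewrite mulrC mulKf.
  apply: (@xgetPex _ 0 [set h | dderiv f (g y) h = k]); exists h => /=.
  by rewrite -[RHS]hE' addrC subrK.
have DK y h : B y -> D y (dderiv f (g y) h) = h.
  move=> By; apply/eqP; rewrite -subr_eq0 -normr_le0.
  apply: le_trans (dfinj y _ By) _.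
  by rewrite (linB _ _ (ldf y By)) KD // subrr normr0 mulr0.
(* By [dfinj] the increment of [D] is at most twice the norm of [z.2 - dderiv f (g z.1) (D y k)],
   which tends to 0. *)
have Dc : {in B `*` [set: E], continuous (fun z : E * E => D z.1 z.2)}.
  move=> [y k]; rewrite inE => -[/= By _]; apply/cvgrPdist_lt => e e0.
  set p := (y, k).
  have a1 : z.1 @[z --> p] --> y by exact: cvg_fst.
  have a2 : z.2 @[z --> p] --> k by exact: cvg_snd.
  have g1 : g z.1 @[z --> p] --> g y by apply: (cvg_comp _ _ a1); apply: gc; rewrite inE.
  have Up : (g y, D y k) \in U `*` [set: E] by rewrite inE; split => //; exact: Ug.
  have df1 : dderiv f (g z.1) (D y k) @[z --> p] --> k.
    rewrite -[X in _ --> X](KD y k By).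
    exact: (cvg_comp _ _ (cvg_to_pair g1 (cvg_cst (D y k))) (fdc _ Up)).
  have e20 : 0 < e / 2 by rewrite divr_gt0.
  have q0 : (z.2 - dderiv f (g z.1) (D y k)) @[z --> p] --> (0 : E).
    by rewrite -(subrr k); exact: tvs_cvgB.
  have q1 : \forall z \near p, `|z.2 - dderiv f (g z.1) (D y k)| < e / 2.
    have /cvgrPdist_lt/(_ _ e20) := q0.
    by apply: filterS => z; rewrite sub0r normrN.
  have Bz : \forall z \near p, B z.1 by exact: (a1 _ (nearB y By)).
  apply: filterS2 q1 Bz => -[y' k'] /= qe By'.
  rewrite distrC; apply: le_lt_trans (dfinj y' _ By') _.
  by rewrite (linB _ _ (ldf y' By')) KD //; lra.
exists (W `&` f @^-1` B), B, g; split.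
  split => //; last by move=> x [/WU].
  - apply: openI_preimage => //; first exact: oball.
    by move=> x; rewrite inE => Wx; apply: fc; rewrite inE; exact: WU.
  - by split; rewrite ?WE /= ?f0 ?BE normr0.
split.
- by move=> x [].
- by move=> y By; have [Wg fg] := gP y By; split => //=; rewrite fg.
- by move=> x; rewrite inE => -[]; exact: fK.
- by move=> y; rewrite inE => /gP[].
- move=> k; refine (@Cn_on_inverse R E E k U B f g D oU oB fC _ _ gc Dc DK KD) => //.
  by move=> y; rewrite inE => /gP[].
Qed.

End inverse_function.

(** * Regular operators *)

Section regular_operators.
Context {R : realType}.
Implicit Types X Y Z : tvsType R.

Definition generalized_inverse X Y (T : X -> Y) (S : Y -> X) : Prop :=
  [/\ linear S, continuous S & forall x, T (S (T x)) = T x].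

Lemma decomposition_projection X (A B : set X) : top_decomposition A B ->
  exists p : X -> X, [/\ linear p, continuous p,
    forall x, A (p x) /\ B (x - p x), forall x, A x -> p x = x
    & forall x, B x -> p x = 0].
Proof.
move=> [[A0 lA] [B0 lB] AB [p pc pAB]].
have lA' (a : R) u v : A u -> A v -> A (a *: u + v).
  by move=> Au Av; apply/set_mem; apply: lA; rewrite inE.
have lB' (a : R) u v : B u -> B v -> B (a *: u + v).
  by move=> Au Av; apply/set_mem; apply: lB; rewrite inE.
have uniq x a : A a -> B (x - a) -> p x = a.
  move=> Aa Ba; have [Ap Bp] := pAB x.
  suff : (A `&` B) (p x - a) by rewrite AB /= => /eqP; rewrite subr_eq0 => /eqP.
  split; first by rewrite addrC -scaleN1r; exact: lA'.
  have := lB' (-1) _ _ Bp Ba.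
  by rewrite scaleN1r opprB addrA subrK.
exists p; split => //.
- move=> a u v; have [Au Bu] := pAB u; have [Av Bv] := pAB v.
  apply: uniq; first exact: lA'.
  by rewrite opprD addrACA -scalerBr; exact: lB'.
- by move=> x Ax; apply: uniq => //; rewrite subrr; exact: set_mem.
- by move=> x Bx; apply: uniq; [exact: set_mem|rewrite subr0].
Qed.

Lemma projection_decomposition X (p : X -> X) : linear p -> continuous p ->
  (forall x, p (p x) = p x) -> top_decomposition [set x | p x = x] [set x | p x = 0].
Proof.
move=> lp pc pp; split.
- split; first by rewrite !inE /= lin0.
  by move=> a u v; rewrite !inE /= lp => -> ->.
- split; first by rewrite !inE /= lin0.
  by move=> a u v; rewrite !inE /= lp => -> ->; rewrite scaler0 addr0.
- apply/seteqP; split=> x /=; first by move=> [px p0]; rewrite -p0 px.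
  by move=> ->; rewrite lin0.
- by exists p => // x; rewrite /= linB // pp subrr.
Qed.

Lemma lin_continuousB X Y (f g : X -> Y) : continuous f -> continuous g ->
  continuous (fun x => f x - g x).
Proof. by move=> fc gc x; apply: tvs_cvgB; [exact: fc|exact: gc]. Qed.

Lemma projection_decompositionC X (p : X -> X) : linear p -> continuous p ->
  (forall x, p (p x) = p x) -> top_decomposition [set x | p x = 0] [set x | p x = x].
Proof.
move=> lp pc pp; pose q x := x - p x.
have -> : [set x | p x = 0] = [set x | q x = x].
  apply/seteqP; split=> x /=; rewrite /q; first by move=> ->; rewrite subr0.
  by move=> /eqP; rewrite -subr_eq0 addrAC subrr add0r oppr_eq0 => /eqP.
have -> : [set x | p x = x] = [set x | q x = 0].
  apply/seteqP; split=> x /=; rewrite /q; first by move=> ->; rewrite subrr.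
  by move=> /eqP; rewrite subr_eq0 => /eqP/esym.
apply: projection_decomposition.
- by move=> a u v; rewrite /q lp scalerBr opprD addrACA.
- by apply: lin_continuousB => // x; exact: cvg_id.
- by move=> x; rewrite /q linB // pp subrr subr0.
Qed.

Lemma closed_eq0 X Y (f : X -> Y) : hausdorff_space Y -> continuous f ->
  closed (f @^-1` [set 0]).
Proof.
move=> hY fc; apply: preimage_closed; first by move=> x _; exact: fc.
exact/accessible_closed_set1/hausdorff_accessible.
Qed.

(** [S \o T] is a continuous projection with the kernel of [T], and [T \o S] is one with the image
    of [T]. *)
Lemma generalized_inverse_regular X Y (T : X -> Y) (S : Y -> X) :
  hausdorff_space Y -> linear T -> continuous T -> generalized_inverse T S ->
  regular_operator T.
Proof.
move=> hY lT Tc [lS Sc TST].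
have STc : continuous (S \o T) by move=> x; apply: continuous_comp; [exact: Tc|exact: Sc].
have TSc : continuous (T \o S) by move=> x; apply: continuous_comp; [exact: Sc|exact: Tc].
have lST : linear (S \o T) by move=> a u v /=; rewrite lT lS.
have lTS : linear (T \o S) by move=> a u v /=; rewrite lS lT.
have kerE : T @^-1` [set 0] = [set x | (S \o T) x = 0].
  apply/seteqP; split=> x /=; first by move=> ->; rewrite lin0.
  by move=> STx; rewrite -TST STx lin0.
have imE : range T = [set y | (T \o S) y = y].
  apply/seteqP; split=> y /=; first by move=> [x _ <-].
  by move=> <-; exists (S y).
split => //.
(* For each [z] the map [fun y => S y + (z - S (T z))] is a continuous section of [T] over its range
   that takes [T z] to [z]; [O] is pulled back along all of them. *)
- move=> O oO; exists (\bigcup_z (fun y => S y + (z - S (T z))) @^-1` O).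
    apply: bigcup_open => z _; apply: open_comp => // y _.
    by apply: tvs_cvgD; [exact: Sc|exact: cvg_cst].
  apply/seteqP; split => y.
    move=> [x Ox <-]; split; last by exists x.
    by exists x => //=; rewrite addrC subrK.
  move=> [[z _ /= Oz] [w _ yE]]; exists (S y + (z - S (T z))) => //.
  by rewrite linD // linB // TST subrr addr0 -yE TST.
- exact: closed_eq0.
- exists [set x | (S \o T) x = x]; rewrite kerE.
  by apply: projection_decompositionC => // x /=; rewrite TST.
- rewrite imE; have -> : [set y | (T \o S) y = y] = (fun y => T (S y) - y) @^-1` [set 0].
    apply/seteqP; split=> y /=; first by move=> ->; rewrite subrr.
    by move=> /eqP; rewrite subr_eq0 => /eqP.
  by apply: closed_eq0 => //; apply: lin_continuousB => // y; exact: cvg_id.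
- exists [set y | (T \o S) y = 0]; rewrite imE.
  by apply: projection_decomposition => // y /=; rewrite TST.
Qed.

(** [S y] is the unique preimage of [q y] in the complement [B] of the kernel. Relative openness of
    [T] makes it continuous. *)
Lemma regular_generalized_inverse X Y (T : X -> Y) : regular_operator T ->
  exists S, generalized_inverse T S.
Proof.
move=> [lT Tc Topen _ [B dB] _ [D dD]].
have [p [lp pc pP pker _]] := decomposition_projection dB.
have [q [lq qc qP qim _]] := decomposition_projection dD.
have /choice[s sE] y : exists x, T x = q y by have [[x _ <-] _] := qP y; exists x.
have Tp x : T (p x) = 0 by have [] := pP x.
pose S y := s y - p (s y).
(* Any preimage of [q y] may replace the chosen [s y]; this independence yields linearity and
   continuity of [S]. *)
have SE y x : T x = q y -> S y = x - p x.
  move=> Tx; rewrite /S.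
  have : p (x - s y) = x - s y by apply: pker; rewrite /= linB // Tx sE subrr.
  rewrite (linB _ _ lp) => e; apply/eqP; rewrite -subr_eq0.
  by rewrite opprD opprK addrACA [- p _ + _]addrC e -opprB addNr.
exists S; split.
- move=> a u v; rewrite (SE _ (a *: s u + s v)); last by rewrite lT !sE lq.
  by rewrite lp opprD addrACA -scalerBr.
- apply/continuousP => O oO.
  have oO' : open ((fun x => x - p x) @^-1` O).
    by apply: open_comp => // x _; apply: tvs_cvgB; [exact: cvg_id|exact: pc].
  have [V oV VE] := Topen _ oO'.
  rewrite (_ : S @^-1` O = q @^-1` V); first by apply: open_comp => // y _; exact: qc.
  apply/seteqP; split=> y /=.
    move=> Oy; have : (V `&` range T) (q y) by rewrite -VE; exists (s y).
    by case.
  move=> Vqy; have : (V `&` range T) (q y) by split => //; have [] := qP y.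
  by rewrite -VE => -[x Ox Txq]; rewrite (SE _ x).
- by move=> x; rewrite /S linB // Tp subr0 sE qim //; exists x.
Qed.

Lemma reflexive_generalized_inverse X Y (T : X -> Y) (S : Y -> X) :
  linear T -> continuous T -> generalized_inverse T S ->
  exists2 S', generalized_inverse T S' & forall y, S' (T (S' y)) = S' y.
Proof.
move=> lT Tc [lS Sc TST]; exists (S \o T \o S); last by move=> y /=; rewrite !TST.
split; first by move=> a u v /=; rewrite lS lT lS.
- move=> y; apply: continuous_comp; first exact: Sc.
  by apply: continuous_comp; [exact: Tc|exact: Sc].
- by move=> x /=; rewrite !TST.
Qed.

End regular_operators.

(** * Normal forms *)

Section charts.
Context {R : realType}.
Implicit Types (X Y : tvsType R).

Lemma open_transition (M : topologicalType) X (c : chart M X) (W : set M) :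
  open W -> open (chart_cod c `&` chart_inv c @^-1` W).
Proof.
move=> oW; apply: openI_preimage => //; [exact: chart_cod_open|].
exact: chart_inv_continuous.
Qed.

Lemma smooth_on_continuous X Y (U : set X) (f : X -> Y) : smooth_on U f ->
  {in U, continuous f}.
Proof. by move=> /(_ 0%N). Qed.

(** The transition maps of the new chart are those of [c] composed with [theta] or [theta']. Its
    fields are exposed as equations for later rewriting. *)
Lemma smooth_chart_comp (E : tvsType R) (M : manifold E) (c : chart M E)
    (A B : set E) (theta theta' : E -> E) :
  atlas c -> open A -> open B -> A `<=` chart_cod c ->
  set_fun A B theta -> set_fun B A theta' ->
  {in A, cancel theta theta'} -> {in B, cancel theta' theta} ->
  smooth_on A theta -> smooth_on B theta' ->
  exists c' : chart M E, [/\ smooth_chart c',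
    chart_dom c' = chart_dom c `&` c @^-1` A, chart_cod c' = B,
    chart_map c' = theta \o c & chart_inv c' = chart_inv c \o theta'].
Proof.
move=> ac oA oB Ac AB BA K K' sm sm'.
have hE := model_hausdorff M.
pose D := chart_dom c `&` c @^-1` A.
have oD : open D.
  by apply: openI_preimage => //; [exact: chart_dom_open|exact: chart_map_continuous].
have DB : set_fun D B (theta \o c) by move=> p [_ /AB].
have BD : set_fun B D (chart_inv c \o theta').
  move=> z /BA Az; have cz := Ac _ Az; split; first exact: chart_invS.
  by rewrite /= chart_invK // inE.
have DK : {in D, cancel (theta \o c) (chart_inv c \o theta')}.
  by move=> p; rewrite inE => -[cp Ap] /=; rewrite K ?inE // chart_mapK // inE.
have BK : {in B, cancel (chart_inv c \o theta') (theta \o c)}.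
  move=> z; rewrite inE => Bz /=; have Az := BA _ Bz; have cz := Ac _ Az.
  by rewrite chart_invK ?inE // K' // inE.
have Dc : {in D, continuous (theta \o c)}.
  move=> p; rewrite inE => -[cp Ap]; apply: continuous_comp.
    by apply: chart_map_continuous; rewrite inE.
  by apply: (smooth_on_continuous sm); rewrite inE.
have Bc : {in B, continuous (chart_inv c \o theta')}.
  move=> z; rewrite inE => Bz; have Az := BA _ Bz; have cz := Ac _ Az.
  apply: continuous_comp; first by apply: (smooth_on_continuous sm'); rewrite inE.
  by apply: chart_inv_continuous; rewrite inE.
exists (Chart oD oB DB BD DK BK Dc Bc); split => // d ad.
have [cd dc] := atlas_compatible ac ad.
have ocd := open_transition c (chart_dom_open d).
have odc := open_transition d (chart_dom_open c).
split; rewrite /smooth_transition /=.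
- have -> : B `&` (chart_inv c \o theta') @^-1` chart_dom d =
      B `&` theta' @^-1` (chart_cod c `&` chart_inv c @^-1` chart_dom d).
    by apply/seteqP; split=> z [Bz]; [move=> dz; split => //; split => //; apply/Ac/BA|case].
  apply: (smooth_on_comp hE hE hE _ ocd _ cd).
  + by apply: openI_preimage => //; exact: smooth_on_continuous.
  + by move=> z [].
  + by apply: smooth_on_subset sm' => z [].
- have -> : chart_cod d `&` chart_inv d @^-1` D =
      (chart_cod d `&` chart_inv d @^-1` chart_dom c) `&` (c \o chart_inv d) @^-1` A.
    by apply/seteqP; split=> z; [move=> [dz [cz Az]]|move=> [[dz cz] Az]].
  apply: (smooth_on_comp hE hE hE _ oA _ sm).
  + by apply: openI_preimage => //; exact: smooth_on_continuous dc.
  + by move=> z [].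
  + by apply: smooth_on_subset dc => z [].
Qed.

End charts.

(** * Local normal form between model spaces *)

Section local_normal_form.
Context {R : realType}.

Definition local_diffeo {X Y : tvsType R} (A : set X) (B : set Y)
    (f : X -> Y) (g : Y -> X) : Prop :=
  [/\ open A, open B, set_fun A B f /\ set_fun B A g,
    {in A, cancel f g} /\ {in B, cancel g f} & smooth_on A f /\ smooth_on B g].

Lemma local_diffeo_restrict (X Y : tvsType R) (A : set X) (B B' : set Y) f g :
  local_diffeo A B f g -> open B' ->
  local_diffeo (A `&` f @^-1` B') (B `&` B') f g.
Proof.
move=> [oA oB [AB BA] [K K'] [fC gC]] oB'; split.
- by apply: openI_preimage => //; exact: smooth_on_continuous.
- exact: openI.
- split=> x [Ax Bx]; first by split => //; exact: AB.
  by split; [exact: BA|rewrite /= K' // inE].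
- by split=> x; rewrite inE => -[Ax _]; [rewrite K // inE|rewrite K' // inE].
- by split; [apply: smooth_on_subset fC => x []|apply: smooth_on_subset gC => x []].
Qed.

Lemma local_diffeo_sym (X Y : tvsType R) (A : set X) (B : set Y) f g :
  local_diffeo A B f g -> local_diffeo B A g f.
Proof. by move=> [oA oB [AB BA] [K K'] [fC gC]]; split. Qed.

Lemma smooth_on_id (X : tvsType R) (U : set X) : hausdorff_space X -> smooth_on U id.
Proof. by move=> hX; apply: smooth_on_lin => // x; exact: cvg_id. Qed.

Lemma smooth_on_shift (X : tvsType R) (U : set X) (a : X) : hausdorff_space X ->
  open U -> smooth_on U (fun x => x + a).
Proof.
by move=> hX oU; apply: smooth_onD => //; [exact: smooth_on_id|exact: smooth_on_cst].
Qed.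

Lemma smooth_on_is_dderiv (X Y : tvsType R) (U : set X) (f : X -> Y) x h :
  smooth_on U f -> U x -> is_dderiv f x h (dderiv f x h).
Proof. by move=> /(_ 1%N)[_ fd _] Ux; exact/dderivableP/fd. Qed.

(* With [phi = id - S T + S g], whose derivative at 0 is the identity, the map
   [gt = g o phi^-1] satisfies [T S (gt z) = T z]; the shear [psi] of the target
   removes the values of [gt] on the coimage of [T]. *)
Lemma local_normal_form (E : completeNormedModType R) (F : normedModType R)
    (U : set E) (g : E -> F) (S : F -> E) :
  let T := dderiv g 0 in
  open U -> U 0 -> smooth_on U g -> g 0 = 0 -> generalized_inverse T S ->
  (forall y, S (T (S y)) = S y) ->
  exists (A B W : set E) (V : set F) (phi phi' : E -> E) (psi psi' : F -> F) (sing : E -> F),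
    [/\ local_diffeo A B phi phi' /\ local_diffeo V V psi psi',
      [/\ A 0, A `<=` U, phi 0 = 0, V 0 & psi 0 = 0],
      [/\ open W, W 0, set_fun W [set y | T (S y) = 0] sing, smooth_on W sing
        & (forall x, W x -> S (T x) = x -> sing x = 0) /\
          (forall h, is_dderiv sing 0 h 0)]
      & [/\ B `<=` W, set_fun A V g &
          forall z, B z -> psi (g (phi' z)) = T z + sing z]].
Proof.
move=> T oU U0 gC g0 [lS Sc TST] STS.
have hE : hausdorff_space E by exact: norm_hausdorff.
have hF : hausdorff_space F by exact: norm_hausdorff.
have gC1 := smooth_on_Cn1 gC.
have lT : linear T by exact: (Cn1_dderiv_linear hF oU gC1).
have Tc : continuous T by exact: (Cn1_dderiv_continuous gC1).
have sT V : smooth_on V T by exact: smooth_on_lin.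
have sS V : smooth_on V S by exact: smooth_on_lin.
have lST : linear (S \o T) by move=> a u v /=; rewrite lT lS.
have STc : continuous (S \o T).
  by move=> x; apply: continuous_comp; [exact: Tc|exact: Sc].
have sST V : smooth_on V (S \o T) by exact: smooth_on_lin.
pose phi x := x - S (T x) + S (g x).
have phiC : smooth_on U phi.
  apply: smooth_onD => //; first by apply: smooth_onB => //; exact: smooth_on_id.
  exact: (smooth_on_comp hE hF hE oU openT _ (sS _) gC).
have phi0 : phi 0 = 0 by rewrite /phi g0 (lin0 lT) (lin0 lS) subrr addr0.
have dphi h : dderiv phi 0 h = h.
  apply: is_dderivE => //.
  have dST : is_dderiv (S \o T) 0 h (S (T h)).
    exact: (is_dderiv_linear _ lST).
  have dSg : is_dderiv (S \o g) 0 h (S (T h)).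
    rewrite -(dderiv_lin (g 0) (T h) hE lS).
    apply: (is_dderiv_comp openT I (smooth_on_Cn1 (sS _))).
    exact: smooth_on_is_dderiv gC U0.
  have did : is_dderiv id 0 h h by exact: (@is_dderiv_linear _ _ _ id).
  have := is_dderivB did (is_dderivB dST dSg).
  rewrite subrr subr0; congr is_dderiv; apply/funext => x.
  by rewrite /phi /= opprB addrA addrAC.
have [A0 [B0 [phi' [[oA0 oB0 A00 A0U] [AB BA K K' phi'C]]]]] :=
  inverse_function oU U0 phiC phi0 dphi.
have phiA0 : smooth_on A0 phi by exact: smooth_on_subset phiC.
have B00 : B0 0 by rewrite -phi0; exact: AB.
have phi'0 : phi' 0 = 0 by rewrite -{1}phi0 K // inE.
have dphi' h : dderiv phi' 0 h = h.
  have d1 : is_dderiv (phi \o phi') 0 h (dderiv phi (phi' 0) (dderiv phi' 0 h)).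
    apply: (is_dderiv_comp oA0); first by rewrite phi'0.
      exact: smooth_on_Cn1.
    exact: smooth_on_is_dderiv phi'C B00.
  rewrite phi'0 dphi in d1; apply: is_dderiv_unique hE d1 _.
  apply: near_eq_is_dderiv (@is_dderiv_linear _ _ _ id 0 h _) => //.
  by apply: open_near_eq oB0 B00 _ => z Bz; rewrite /= K'.
pose gt := g \o phi'.
have gtC : smooth_on B0 gt.
  apply: (smooth_on_comp hE hE hF oB0 oU _ gC phi'C).
  by move=> z /BA /A0U.
have gt0 : gt 0 = 0 by rewrite /gt /= phi'0.
have dgt h : is_dderiv gt 0 h (T h).
  have : is_dderiv (g \o phi') 0 h (dderiv g (phi' 0) (dderiv phi' 0 h)).
    apply: (is_dderiv_comp oU _ gC1); first by rewrite phi'0.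
    exact: smooth_on_is_dderiv phi'C B00.
  by rewrite phi'0 dphi'.
(* Applying [T] to [phi x] leaves [T (S (g x))], because [T S T = T]. *)
have TSgt z : B0 z -> T (S (gt z)) = T z.
  move=> Bz; rewrite -{2}(K' z) ?inE // /phi (linD _ _ lT) (linB _ _ lT) TST.
  by rewrite subrr add0r.
(* [Q] projects onto the kernel of [T \o S] along the image of [T]. *)
pose Q y := y - T (S y).
have lQ : linear Q by move=> a u v; rewrite /Q lS lT scalerBr opprD addrACA.
have Qc : continuous Q.
  apply: lin_continuousB; first by move=> y; exact: cvg_id.
  by move=> y; apply: continuous_comp; [exact: Sc|exact: Tc].
have sQ V : smooth_on V Q by exact: smooth_on_lin.
have SQ y : S (Q y) = 0 by rewrite /Q (linB _ _ lS) STS subrr.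
have QT x : Q (T x) = 0 by rewrite /Q TST subrr.
have gtE z : B0 z -> gt z = T z + Q (gt z).
  by move=> Bz; rewrite /Q TSgt // addrC subrK.
pose sing z := Q (gt z - gt (S (T z))).
(* Both [z] and [S (T z)] have to lie in the domain [B0] of [gt] for [sing] to be smooth. *)
pose W := B0 `&` (S \o T) @^-1` B0.
have oW : open W by apply: openI_preimage => // x _; exact: STc.
have W0 : W 0 by split => //=; rewrite (lin0 lT) (lin0 lS).
pose V := S @^-1` B0.
have oV : open V by apply: open_comp => // y _; exact: Sc.
pose psi y := y - Q (gt (S y)); pose psi' y := y + Q (gt (S y)).
(* [S] kills [Q], so the shears preserve [S y]; hence [V] is invariant and [psi'] undoes [psi]. *)
have Spsi y : S (psi y) = S y by rewrite /psi (linB _ _ lS) SQ subr0.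
have Spsi' y : S (psi' y) = S y by rewrite /psi' (linD _ _ lS) SQ addr0.
have QgtS : smooth_on V (fun y => Q (gt (S y))).
  apply: (smooth_on_comp (g := Q \o gt) hF hE hF oV oB0 _ _ (sS V)) => //.
  exact: (smooth_on_comp hE hF hF oB0 openT (fun _ _ => I) (sQ _) gtC).
have dV : local_diffeo V V psi psi'.
  split => //.
  - by split=> y Vy; rewrite /V /= ?Spsi ?Spsi'.
  - split=> y _; first by rewrite /psi' Spsi /psi subrK.
    by rewrite /psi Spsi' /psi' addrK.
  - split; first by apply: smooth_onB => //; exact: smooth_on_id.
    by apply: smooth_onD => //; exact: smooth_on_id.
have oW' : open (W `&` gt @^-1` V).
  apply: openI_preimage => // z; rewrite inE => -[Bz _].
  by apply: (smooth_on_continuous gtC); rewrite inE.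
have V0 : V 0 by rewrite /V /= (lin0 lS).
have dB0 : local_diffeo A0 B0 phi phi' by split.
have dB := local_diffeo_restrict dB0 oW'.
exists (A0 `&` phi @^-1` (W `&` gt @^-1` V)), (B0 `&` (W `&` gt @^-1` V)), W, V.
exists phi, phi', psi, psi', sing; split => //.
- split => //; first by split => //=; rewrite phi0; split => //=; rewrite gt0.
    by move=> x [/A0U].
  by rewrite /psi (lin0 lS) gt0 (lin0 lQ) subrr.
- split => //.
  + by move=> z _ /=; rewrite SQ (lin0 lT).
  + have gtST : smooth_on W (fun z => gt (S (T z))).
      by apply: (smooth_on_comp hE hE hF oW oB0 _ gtC (sST W)) => z [].
    apply: (smooth_on_comp (g := Q) hE hF hF oW openT _ (sQ _) _) => //.
    by apply: smooth_onB => //; apply: smooth_on_subset gtC => z [].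
  + split; first by move=> x _ STx; rewrite /sing STx subrr (lin0 lQ).
    (* The derivative of [sing] at 0 is [Q (T h - T (S (T h)))], which is 0. *)
    move=> h.
    have dST : is_dderiv (S \o T) 0 h (S (T h)).
      exact: (is_dderiv_linear _ lST).
    have dgtST : is_dderiv (gt \o (S \o T)) 0 h (T (S (T h))).
      have ST0 : (S \o T) 0 = 0 by rewrite /= (lin0 lT) (lin0 lS).
      rewrite -(is_dderivE hF (dgt (S (T h)))).
      have := is_dderiv_comp oB0 _ (smooth_on_Cn1 gtC) dST.
      by rewrite ST0; apply.
    have dd := is_dderivB (dgt h) dgtST.
    rewrite TST subrr in dd.
    have := is_dderiv_comp openT I (smooth_on_Cn1 (sQ setT)) dd.
    by rewrite dderiv_lin // (lin0 lQ).
- split; first by move=> z [_ []].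
    move=> x [Ax [_ /=]]; rewrite /V /gt /= K ?inE //.
  move=> z [Bz _]; rewrite /psi -/(gt z) /sing (linB _ _ lQ).
  (* So the shear subtracts [Q] of [gt] at [S (T z)], the second term of [sing]. *)
  have -> : S (gt z) = S (T z) by rewrite -STS TSgt.
  by rewrite addrA -gtE.
Qed.

End local_normal_form.

(** * From a generalized inverse to a normal form *)

Section sufficiency.
Context {R : realType}.

(** The local normal form is centered at 0, whereas [chart_at] may send the point elsewhere;
    translations make up the difference. *)
Lemma local_diffeo_shift (X Y : tvsType R) (A : set X) (B : set Y) f g (a : X) :
  hausdorff_space X -> hausdorff_space Y -> local_diffeo A B f g ->
  local_diffeo [set x | A (x - a)] B (fun x => f (x - a)) (fun y => g y + a).
Proof.
move=> hX hY [oA oB [AB BA] [K K'] [fC gC]].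
have sa V : open V -> smooth_on V (fun x : X => x - a) by exact: smooth_on_shift.
have sb V : open V -> smooth_on V (fun x : X => x + a) by exact: smooth_on_shift.
have oA' : open [set x | A (x - a)].
  by apply: (@open_comp _ _ (fun x => x - a) A) => // x _;
    apply: (smooth_on_continuous (sa _ openT)); rewrite inE.
split => //.
- by split=> x; [exact: AB|move=> /BA; rewrite /= addrK].
- split=> x; rewrite inE /=; first by move=> Ax; rewrite K ?inE // subrK.
  by move=> Bx; rewrite addrK K' // inE.
- split; first exact: (smooth_on_comp hX hX hY oA' oA _ fC (sa _ oA')).
  exact: (smooth_on_comp hY hX hX oB openT (fun _ _ => I) (sb _ openT) gC).
Qed.

Lemma smooth_chart_local_diffeo (E : tvsType R) (M : manifold E) (c : chart M E)
    (A B : set E) (theta theta' : E -> E) :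
  atlas c -> local_diffeo A B theta theta' -> A `<=` chart_cod c ->
  exists c' : chart M E, [/\ smooth_chart c',
    chart_dom c' = chart_dom c `&` c @^-1` A, chart_cod c' = B,
    chart_map c' = theta \o c & chart_inv c' = chart_inv c \o theta'].
Proof.
move=> ac [oA oB [AB BA] [K K'] [tC t'C]] Ac.
exact: (smooth_chart_comp ac oA oB Ac AB BA K K' tC t'C).
Qed.

Lemma open_smooth_map_dom (E F : tvsType R) (M : manifold E) (N : manifold F)
    (f : M -> N) (c : chart M E) (d : chart N F) : smooth_map f ->
  open (chart_cod c `&` (f \o chart_inv c) @^-1` chart_dom d).
Proof.
move=> [fc _]; apply: (@open_transition R M E c (f @^-1` chart_dom d)).
by apply: open_comp; [move=> x _; exact: fc|exact: chart_dom_open].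
Qed.

Lemma smooth_map_dom_chart_at (E F : tvsType R) (M : manifold E) (N : manifold F)
    (f : M -> N) (m : M) :
  (chart_cod (chart_at m) `&`
    (f \o chart_inv (chart_at m)) @^-1` chart_dom (chart_at (f m))) (chart_at m m).
Proof.
have cm := chart_at_dom m; split; first exact: chart_mapS.
by rewrite /= chart_mapK ?inE //; exact: chart_at_dom.
Qed.

Lemma tangent_map_linear_continuous (E F : tvsType R) (M : manifold E) (N : manifold F)
    (f : M -> N) (m : M) : smooth_map f ->
  linear (tangent_map f m : E -> F) /\ continuous (tangent_map f m : E -> F).
Proof.
move=> fC; have hF := model_hausdorff N.
have oU0 := open_smooth_map_dom (chart_at m) (chart_at (f m)) fC.
have gC := smooth_on_Cn1 (fC.2 _ _ (chart_at_atlas m) (chart_at_atlas (f m))).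
have Um := smooth_map_dom_chart_at f m.
by split; [exact: Cn1_dderiv_linear hF oU0 gC Um|exact: Cn1_dderiv_continuous gC Um].
Qed.

(** The charts are those of [chart_at], translated to 0 and composed with [phi] and [psi]; the
    subspaces are the kernels and images of [S' \o T] and [T \o S']. This serves both halves of the
    theorem. *)
Lemma has_normal_form_generalized_inverse (E : completeNormedModType R)
    (F : normedModType R) (M : manifold E) (N : manifold F) (f : M -> N) (m : M)
    (S : F -> E) :
  smooth_map f -> generalized_inverse (tangent_map f m : E -> F) S ->
  has_normal_form f m.
Proof.
move=> fC; have [lT Tc] := tangent_map_linear_continuous m fC.
move: lT Tc; set T : E -> F := tangent_map f m => lT Tc TS.
have hE : hausdorff_space E by exact: norm_hausdorff.
have hF : hausdorff_space F by exact: norm_hausdorff.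
pose c := chart_at m; pose d := chart_at (f m).
have cm : chart_dom c m by exact: chart_at_dom.
have dm : chart_dom d (f m) by exact: chart_at_dom.
pose x0 : E := c m; pose y0 : F := d (f m).
have cK : chart_inv c x0 = m by rewrite chart_mapK // inE.
pose U0 := chart_cod c `&` (f \o chart_inv c) @^-1` chart_dom d.
have U0C : smooth_on U0 (d \o f \o chart_inv c).
  exact: (fC.2 _ _ (chart_at_atlas _) (chart_at_atlas _)).
have oU0 : open U0 by exact: open_smooth_map_dom.
pose U := [set x | U0 (x + x0)].
have sx0 V : open V -> smooth_on V (fun x : E => x + x0) by exact: smooth_on_shift.
have oU : open U.
  apply: (@open_comp _ _ (fun x => x + x0) U0) => // x _.
  by apply: (smooth_on_continuous (sx0 _ openT)); rewrite inE.
have U0x0 : U0 x0 by exact: smooth_map_dom_chart_at.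
have U00 : U 0 by rewrite /U /= add0r.
pose g x := d (f (chart_inv c (x + x0))) - y0.
have gC : smooth_on U g.
  apply: smooth_onB => //; last exact: smooth_on_cst.
  exact: (smooth_on_comp hE hE hF oU oU0 _ U0C (sx0 _ oU)).
have g0 : g 0 = 0 by rewrite /g add0r cK subrr.
(* Translations in source and target leave the difference quotients unchanged. *)
have dg : dderiv g 0 = T.
  apply/funext => h; rewrite /T /tangent_map /dderiv; congr xget.
  apply/seteqP; split=> y; rewrite /is_dderiv /=; apply: near_eq_cvg_to; apply: nearW => t;
    by rewrite /g /= addr0 add0r -/c -/d -/x0 opprB addrA subrK.
have [S' TS' S'TS'] := reflexive_generalized_inverse lT Tc TS.
move: (TS'); rewrite -dg => dgS'.
have S'dgS' y : S' (dderiv g 0 (S' y)) = S' y by rewrite dg.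
have [A [B [W [V [phi [phi' [psi [psi' [sing]]]]]]]]] :=
  local_normal_form oU U00 gC g0 dgS' S'dgS'.
rewrite dg => -[[dA dV] [A0 AU phi0 V0 psi0] [oW W0 singK singC [sing0 dsing]] [BW gV nfE]].
have [lS Sc TST] := TS'.
have lST : linear (S' \o T) by move=> a u v /=; rewrite lT lS.
have lTS : linear (T \o S') by move=> a u v /=; rewrite lS lT.
have STc : continuous (S' \o T).
  by move=> x; apply: continuous_comp; [exact: Tc|exact: Sc].
have TSc : continuous (T \o S').
  by move=> x; apply: continuous_comp; [exact: Sc|exact: Tc].
have decE : top_decomposition [set x | S' (T x) = 0] [set x | S' (T x) = x].
  by apply: (projection_decompositionC lST STc) => x /=; rewrite TST.
have decF : top_decomposition [set y | T (S' y) = 0] [set y | T (S' y) = y].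
  by apply: (projection_decompositionC lTS TSc) => x /=; rewrite TST.
have isoT : linear_homeo_on [set x | S' (T x) = x] [set y | T (S' y) = y] T.
  split.
  - by move=> a u v _ _; exact: lT.
  - split.
    + by move=> x /= STx; rewrite STx.
    + by move=> u v; rewrite !inE /= => uE vE Tuv; rewrite -[LHS]uE -[RHS]vE Tuv.
    + by move=> y /= TSy; exists (S' y) => //=; rewrite TSy.
  - exact: continuous_subspaceT.
  - exists S'; first exact: continuous_subspaceT.
    by move=> x; rewrite inE.
exists (@NormalForm R E F hE hF _ _ _ _ decE decF T isoT W oW W0 sing singK singC sing0 dsing).
have [kappa [skappa dkappa codkappa kE kinvE]] := smooth_chart_local_diffeo
  (chart_at_atlas m) (local_diffeo_shift x0 hE hE dA)
  (fun x (Ax : A (x - x0)) => (eq_ind (x - x0 + x0) (chart_cod c) (AU _ Ax).1 x (subrK x0 x))).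
(* The translate of [V] is intersected with [chart_cod d]. Restriction acts on the target set of a
   diffeomorphism, hence the two symmetries. *)
have dV' := local_diffeo_sym (local_diffeo_restrict
  (local_diffeo_sym (local_diffeo_shift y0 hF hF dV)) (chart_cod_open d)).
have [rho [srho drho codrho rE rinvE]] := smooth_chart_local_diffeo
  (chart_at_atlas (f m)) dV' (@subIsetr _ _ _).
exists kappa, rho; split => //.
- split; first by rewrite dkappa; split => //=; rewrite -/c -/x0 subrr.
  by rewrite kE /= -/c -/x0 subrr.
- split; last by rewrite rE /= -/d -/y0 subrr.
  rewrite drho; split => //=; rewrite -/d -/y0 subrr; split => //.
  exact: chart_mapS.
- split; last by rewrite codkappa.
  move=> p; rewrite dkappa drho => -[cp /= Ap].
  have [Up1 Up2] : U0 (c p) by have := AU _ Ap; rewrite /U /= subrK.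
  have pK : chart_inv c (c p) = p by rewrite chart_mapK // inE.
  have dfp : chart_dom d (f p) by rewrite -pK.
  split => //=; split; last exact: chart_mapS.
  by have := gV _ Ap; rewrite /g subrK pK.
- move=> x1 x2 /= kx1 cx2; rewrite codkappa => Bx.
  rewrite kinvE rE /= -/d -/c; have := nfE _ Bx; rewrite /g => ->.
  (* [T x1 = T (S' (T x1)) = T 0], so only [T x2] remains. *)
  by rewrite (linD _ _ lT) -(TST x1) kx1 (lin0 lT) add0r.
Qed.

End sufficiency.

(** * From a normal form to a generalized inverse *)

Section necessity.
Context {R : realType}.

(** [nf_hat] and its inverse are continuous only on subspaces; after a continuous projection onto
    the subspace, the composite is continuous everywhere. *)
Lemma within_continuous_comp (X Y Z : topologicalType) (A : set Y) (f : X -> Y) (g : Y -> Z) :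
  continuous f -> (forall x, A (f x)) -> {within A, continuous g} ->
  continuous (g \o f).
Proof.
move=> fc fA /subspace_continuousP gc x W /(gc _ (fA x)) gW.
have H : \forall z \near x, A (f z) -> W (g (f z)) := fc x _ gW.
change (nbhs x ((g \o f) @^-1` W)); apply: filterS H => z; exact.
Qed.

Lemma is_dderivD (X Y : tvsType R) (f g : X -> Y) x h y z :
  is_dderiv f x h y -> is_dderiv g x h z -> is_dderiv (fun x => f x + g x) x h (y + z).
Proof.
move=> fy gz; rewrite /is_dderiv; apply: near_eq_cvg_to (tvs_cvgD fy gz).
by apply: nearW => t; rewrite -scalerDr opprD addrACA.
Qed.

(** The chain rule for mutually inverse transition maps; it makes the derivatives of chart changes
    invertible. *)
Lemma transition_dderivK (M : topologicalType) (X Y : tvsType R)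
    (c : chart M X) (d : chart M Y) m h :
  hausdorff_space X -> hausdorff_space Y -> compatible c d ->
  chart_dom c m -> chart_dom d m ->
  dderiv (c \o chart_inv d) (d m) (dderiv (d \o chart_inv c) (c m) h) = h.
Proof.
move=> hX hY [cdC dcC] cm dm.
have ocd := open_transition c (chart_dom_open d).
have odc := open_transition d (chart_dom_open c).
have cK : chart_inv c (c m) = m by rewrite chart_mapK // inE.
have dK : chart_inv d (d m) = m by rewrite chart_mapK // inE.
have cdm : (chart_cod c `&` chart_inv c @^-1` chart_dom d) (c m).
  by split; [exact: chart_mapS|rewrite /= cK].
have dcm : (chart_cod d `&` chart_inv d @^-1` chart_dom c) (d m).
  by split; [exact: chart_mapS|rewrite /= dK].
have d1 := smooth_on_is_dderiv (h := h) cdC cdm.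
have dcm' : (chart_cod d `&` chart_inv d @^-1` chart_dom c) ((d \o chart_inv c) (c m)).
  by rewrite /= cK.
have e : (d \o chart_inv c) (c m) = d m by rewrite /= cK.
have := is_dderiv_comp odc dcm' (smooth_on_Cn1 dcC) d1.
rewrite e => d2; apply: is_dderiv_unique hX d2 _.
apply: near_eq_is_dderiv (@is_dderiv_linear _ _ _ id (c m) h _) => //.
apply: open_near_eq ocd cdm _ => z; rewrite inE => -[cz dz] /=.
by rewrite chart_mapK ?inE // chart_invK // inE.
Qed.

(** In the given charts the derivative at 0 is [L], which is [nf_hat] after the projection [P] onto
    [nf_coim]; its generalized inverse [L'] is [hatinv] after the projection [Q] onto [nf_im]. Chart
    changes turn these into [B \o L \o A] and [A' \o L' \o B']. *)
Lemma normal_form_generalized_inverse (E F : tvsType R) (M : manifold E)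
    (N : manifold F) (f : M -> N) (m : M) : has_normal_form f m ->
  [/\ linear (tangent_map f m : E -> F), continuous (tangent_map f m : E -> F)
    & exists S, generalized_inverse (tangent_map f m : E -> F) S].
Proof.
move=> [nf [kappa [rho [[skappa srho] [kdom k0] [rdom r0] [fdom kW] nfE]]]].
have hE := model_hausdorff M; have hF := model_hausdorff N.
have hX := @nf_X_hausdorff _ nf; have hY := @nf_Y_hausdorff _ nf.
pose c := chart_at m; pose d := chart_at (f m).
have cm : chart_dom c m by exact: chart_at_dom.
have dm : chart_dom d (f m) by exact: chart_at_dom.
have kc := skappa c (chart_at_atlas m).
have rd := srho d (chart_at_atlas (f m)).
have [p [lp pc pP pker pcoim]] := decomposition_projection (nf_X_decomposition nf).
have [q [lq qc qP qcoker qim]] := decomposition_projection (nf_Y_decomposition nf).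
have [hatL hatB hatc [hatinv hatinvc hatK]] := nf_hat_iso nf.
pose P x := x - p x; pose Q y := y - q y.
have lP : linear P by move=> a u v; rewrite /P lp scalerBr opprD addrACA.
have lQ : linear Q by move=> a u v; rewrite /Q lq scalerBr opprD addrACA.
have Pc : continuous P by apply: lin_continuousB => // x; exact: cvg_id.
have Qc : continuous Q by apply: lin_continuousB => // x; exact: cvg_id.
have PX x : nf_coim nf (P x) by have [] := pP x.
have QY y : nf_im nf (Q y) by have [] := qP y.
pose L x := nf_hat nf (P x).
have lL : linear L by move=> a u v; rewrite /L lP hatL.
have Lc : continuous L by exact: (within_continuous_comp Pc PX hatc).
pose L' y := hatinv (Q y).
have L'c : continuous L' by exact: (within_continuous_comp Qc QY hatinvc).
have [hatF hatI hatS] := hatB.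
(* [hatinv] is linear on [nf_im] because it inverts a bijection that is linear on [nf_coim]. *)
have lL' : linear L'.
  move=> a u v; rewrite /L' lQ.
  have [x Cx <-] := hatS _ (QY u); have [y Cy <-] := hatS _ (QY v).
  have Cxy : nf_coim nf (a *: x + y).
    have [_ [_ lC] _ _] := nf_X_decomposition nf.
    by apply/set_mem; apply: lC; rewrite inE.
  by rewrite -hatL // !hatK // inE.
have LL' x : L (L' (L x)) = L x.
  have QL : Q (L x) = L x by rewrite /Q qim ?subr0 //; exact: hatF.
  have PP : P (P x) = P x.
    by rewrite {1}/P {2}/P (linB _ _ lp) (pker (p x)) ?subrr ?subr0 //; have [] := pP x.
  have -> : L' (L x) = P x by rewrite /L' QL /L hatK // inE.
  by rewrite /L PP.
pose h := rho \o f \o chart_inv kappa.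
have hC : smooth_on (chart_cod kappa) h.
  have hNF : smooth_on (chart_cod kappa) (fun x => L x + nf_sing nf x).
    apply: smooth_onD => //; first exact: chart_cod_open.
      exact: smooth_on_lin.
    exact: smooth_on_subset (nf_sing_smooth nf).
  apply: eq_smooth_on hNF; first exact: chart_cod_open.
  move=> x; rewrite inE => kx; have [px Px] := pP x.
  have xE : p x + P x = x by rewrite /P addrC subrK.
  by have := nfE _ _ px Px; rewrite -/(P x) xE => /(_ kx) <-.
have kK : chart_inv kappa (kappa m) = m by rewrite chart_mapK // inE.
have kcod0 : chart_cod kappa 0 by rewrite -k0; exact: chart_mapS.
have dh v : dderiv h 0 v = L v.
  apply: is_dderivE => //.
  have : is_dderiv (fun x => L x + nf_sing nf x) 0 v (L v).
    by rewrite -[L v]addr0; apply: is_dderivD; [exact: is_dderiv_linear|exact: nf_sing_deriv0].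
  apply: near_eq_is_dderiv; apply: open_near_eq (chart_cod_open kappa) kcod0 _.
  move=> x; rewrite inE => kx; have [px Px] := pP x.
  have xE : p x + P x = x by rewrite /P addrC subrK.
  by have := nfE _ _ px Px; rewrite -/(P x) xE => /(_ kx) <-.
pose A : E -> nf_X nf := dderiv (kappa \o chart_inv c) (c m).
pose A' : nf_X nf -> E := dderiv (c \o chart_inv kappa) (kappa m).
pose B : nf_Y nf -> F := dderiv (d \o chart_inv rho) (rho (f m)).
pose B' : F -> nf_Y nf := dderiv (rho \o chart_inv d) (d (f m)).
have AK v : A' (A v) = v by exact: (transition_dderivK v hE hX (conj kc.2 kc.1)).
have KA v : A (A' v) = v by exact: (transition_dderivK v hX hE kc).
have BK v : B' (B v) = v by exact: (transition_dderivK v hY hF rd).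
have KB v : B (B' v) = v by exact: (transition_dderivK v hF hY (conj rd.2 rd.1)).
have cK : chart_inv c (c m) = m by rewrite chart_mapK // inE.
have dK : chart_inv d (d (f m)) = f m by rewrite chart_mapK // inE.
have rK : chart_inv rho (rho (f m)) = f m by rewrite chart_mapK // inE.
have linC (X Y : tvsType R) (M' : topologicalType) (a : chart M' X) (b : chart M' Y) m' :
    hausdorff_space Y -> smooth_transition a b -> chart_dom a m' -> chart_dom b m' ->
    linear (dderiv (b \o chart_inv a) (a m')) /\ continuous (dderiv (b \o chart_inv a) (a m')).
  move=> hY' abC am bm.
  have abm : (chart_cod a `&` chart_inv a @^-1` chart_dom b) (a m').
    by split; [exact: chart_mapS|rewrite /= chart_mapK // inE].
  have oab := open_transition a (chart_dom_open b).
  split; first exact: (Cn1_dderiv_linear hY' oab (smooth_on_Cn1 abC)).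
  exact: (Cn1_dderiv_continuous (smooth_on_Cn1 abC)).
have [lA Ac] : linear A /\ continuous A := linC _ _ _ _ _ _ hX kc.2 cm kdom.
have [lA' A'c] : linear A' /\ continuous A' := linC _ _ _ _ _ _ hE kc.1 kdom cm.
have [lB Bc] : linear B /\ continuous B := linC _ _ _ _ _ _ hF rd.1 rdom dm.
have [lB' B'c] : linear B' /\ continuous B' := linC _ _ _ _ _ _ hY rd.2 dm rdom.
have TE v : tangent_map f m v = B (L (A v)) :> F.
  apply: is_dderivE => //; rewrite -/c -/d.
  have ocm : open (chart_cod c `&` chart_inv c @^-1` chart_dom kappa).
    exact: open_transition (chart_dom_open kappa).
  have cmk : (chart_cod c `&` chart_inv c @^-1` chart_dom kappa) (c m).
    by split; [exact: chart_mapS|rewrite /= cK].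
  have a0 : (kappa \o chart_inv c) (c m) = 0 by rewrite /= cK.
  have da : is_dderiv (kappa \o chart_inv c) (c m) v (A v).
    exact: smooth_on_is_dderiv kc.2 cmk.
  have dha : is_dderiv (h \o (kappa \o chart_inv c)) (c m) v (L (A v)).
    have := is_dderiv_comp (chart_cod_open kappa) _ (smooth_on_Cn1 hC) da.
    by rewrite a0 dh; apply.
  have ord := open_transition rho (chart_dom_open d).
  have hE0 : (h \o (kappa \o chart_inv c)) (c m) = rho (f m).
    by rewrite /h /= cK kK.
  have rdm : (chart_cod rho `&` chart_inv rho @^-1` chart_dom d) (rho (f m)).
    by split; [exact: chart_mapS|rewrite /= rK].
  have := is_dderiv_comp ord _ (smooth_on_Cn1 rd.1) dha.
  rewrite hE0 => /(_ rdm); apply: near_eq_is_dderiv.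
  (* Near [c m] the representative of [f] in [c] and [d] factors through [kappa] and [rho]. *)
  apply: open_near_eq ocm cmk _ => z; rewrite inE => -[cz kz].
  have kzK : chart_inv kappa (kappa (chart_inv c z)) = chart_inv c z.
    by rewrite chart_mapK // inE.
  by rewrite /h /= kzK chart_mapK // inE; exact: fdom.
have TE' : (tangent_map f m : E -> F) = B \o L \o A by apply/funext => v; exact: TE.
split; rewrite TE'.
- by move=> a u v /=; rewrite lA lL lB.
- move=> x; apply: continuous_comp; first exact: Ac.
  by apply: continuous_comp; [exact: Lc|exact: Bc].
- exists (A' \o L' \o B'); split.
  + by move=> a u v /=; rewrite lB' lL' lA'.
  + move=> x; apply: continuous_comp; first exact: B'c.
    by apply: continuous_comp; [exact: L'c|exact: A'c].
  + by move=> x /=; rewrite BK KA LL'.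
Qed.

End necessity.

(** * Finite-dimensional spaces *)

Section finite_dimension.
Context {R : realType}.

Lemma continuous_tvs_sum (T : topologicalType) (Z : tvsType R) (I : Type) (r : seq I)
    (f : I -> T -> Z) :
  (forall i, continuous (f i)) -> continuous (fun u => \sum_(i <- r) f i u).
Proof.
move=> fc; elim: r => [|i r IH] u.
  rewrite (_ : (fun _ => _) = fun=> 0); first exact: cvg_cst.
  by apply/funext => v; rewrite big_nil.
rewrite (_ : (fun _ => _) = fun v => f i v + \sum_(j <- r) f j v).
  by apply: tvs_cvgD; [exact: fc|exact: IH].
by apply/funext => v; rewrite big_cons.
Qed.

Lemma continuous_rV_combination (Z : tvsType R) n (b : 'I_n -> Z) :
  continuous (fun u : 'rV[R]_n => \sum_i u 0 i *: b i).
Proof.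
apply: continuous_tvs_sum => i u.
have ui : v 0 i @[v --> u] --> u 0 i by exact: coord_continuous.
exact: (tvs_cvgZ ui (cvg_cst (b i))).
Qed.

(** A spanning family of minimal length is independent: a nontrivial relation would allow one vector
    to be dropped. *)
Lemma finite_dimensional_basis (V : lmodType R) : finite_dimensional V ->
  exists (n : nat) (b : 'I_n -> V),
    (forall v, exists a : 'rV[R]_n, v = \sum_i a 0 i *: b i) /\
    (forall a : 'rV[R]_n, \sum_i a 0 i *: b i = 0 -> a = 0).
Proof.
move=> [n0 [b0 b0P]].
pose spans n := `[< exists b : 'I_n -> V,
  forall v, exists a : 'rV[R]_n, v = \sum_i a 0 i *: b i >].
have ex : exists n, spans n.
  exists n0; apply/asboolP; exists b0 => v; have [a ->] := b0P v.
  by exists (\row_i a i); apply: eq_bigr => i _; rewrite mxE.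
case: (ex_minnP ex) => n /asboolP[b bP] nmin; exists n, b; split => // u u0.
apply/rowP => j; rewrite mxE; apply/eqP; apply: contraT => uj.
case: n b bP nmin u u0 j uj => [|n] b bP nmin u u0 j uj; first by case: j uj.
suff /nmin : spans n by rewrite ltnn.
apply/asboolP; exists (fun k => b (lift j k)) => v; have [a ->] := bP v.
move: u0; rewrite (bigD1_ord j) //= => /eqP; rewrite addr_eq0 => /eqP u0.
(* Solving the relation for [b j] and substituting gives the coefficients of [v] in the shorter
   family. *)
have bj : b j = - (u 0 j)^-1 *: \sum_i u 0 (lift j i) *: b (lift j i).
  by rewrite scaleNr -scalerN -u0 scalerA mulVf // scale1r.
exists (\row_k (a 0 (lift j k) - a 0 j / u 0 j * u 0 (lift j k))).
rewrite (bigD1_ord j) //= bj scalerA scaler_sumr -big_split /=.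
apply: eq_bigr => k _; rewrite mxE scalerBl addrC scalerA -scaleNr.
by rewrite mulrN mulNr.
Qed.

(** The bound on [co] holds because the norm of [L u] has a positive minimum on the compact unit
    sphere of row vectors. *)
Lemma finite_dimensional_coordinates (E : normedModType R) : finite_dimensional E ->
  exists (n : nat) (L : 'rV[R]_n -> E) (co : E -> 'rV[R]_n) (C : R),
    [/\ linear L, linear co, continuous L, cancel co L
      & cancel L co /\ (0 < C /\ forall x, `|co x| <= C * `|x|)].
Proof.
move=> /finite_dimensional_basis[n [b [bP bI]]].
pose L (u : 'rV[R]_n) := \sum_i u 0 i *: b i.
have lL : linear L.
  move=> a u v; rewrite /L scaler_sumr -big_split /=; apply: eq_bigr => i _.
  by rewrite !mxE scalerDl scalerA.
have /choice[co coP] v : exists a, v = L a by exact: bP.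
have coK : cancel co L by move=> v; rewrite -coP.
have Linj u v : L u = L v -> u = v.
  move=> uv; apply/eqP; rewrite -subr_eq0; apply/eqP/bI.
  have -> : \sum_i (u - v) 0 i *: b i = L u - L v.
    by rewrite -sumrB; apply: eq_bigr => i _; rewrite !mxE scalerBl.
  by rewrite uv subrr.
have LK : cancel L co by move=> u; apply: Linj; rewrite coK.
have lco : linear co by move=> a u v; apply: Linj; rewrite lL !coK.
have Lc : continuous L by exact: continuous_rV_combination.
pose A : set 'rV[R]_n := [set u | `|u| = 1].
have cA : compact A.
  apply: bounded_closed_compact.
    by exists 1; split; [exact: num_real|move=> M M1 u /= ->; exact: ltW].
  apply: (@preimage_closed _ _ (fun u : 'rV[R]_n => `|u|) [set 1]).
    by move=> x _; exact: norm_continuous.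
  exact: closed_eq.
suff [C C0 HC] : exists2 C : R, 0 < C & forall u, `|u| <= C * `|L u|.
  exists n, L, co, C; split => //; split => //; split => // x.
  by rewrite -{2}(coK x).
have sphere u : u != 0 -> A (`|u|^-1 *: u).
  by move=> u0; rewrite /A /= normrZ normfV normr_id mulVf // normr_eq0.
(* If the sphere is empty ([n = 0]), every row vector is 0 and any positive constant serves. *)
have [A0|A0] := pselect (A !=set0); last first.
  exists 1 => // u; have [->|u0] := eqVneq u 0; first by rewrite normr0 mul1r.
  by exfalso; apply: A0; eexists; exact: sphere u0.
have [|c cA' cmin] := @EVT_min_rV R n (fun u => `|L u|) A A0 cA _.
  apply: continuous_subspaceT => u.
  by apply: continuous_comp; [exact: Lc|exact: norm_continuous].
have c0 : 0 < `|L c|.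
  rewrite normr_gt0; apply/eqP => Lc0; have := set_mem cA'.
  by rewrite /A /= (bI c Lc0) normr0 => /eqP; rewrite eq_sym oner_eq0.
exists `|L c|^-1; first by rewrite invr_gt0.
move=> u; have [->|u0] := eqVneq u 0.
  by rewrite normr0 mulr_ge0 // invr_ge0.
have := cmin _ (mem_set (sphere _ u0)); rewrite (linZ _ _ lL) normrZ normfV normr_id.
rewrite ler_pdivlMl ?normr_gt0 // => h.
by rewrite ler_pdivlMl // mulrC.
Qed.

(** The bounded map [co] carries Cauchy filters to row vectors, where they converge, and [L] carries
    the limit back. *)
Lemma finite_dimensional_complete (E : normedModType R) : finite_dimensional E ->
  forall G : set_system E, ProperFilter G -> cauchy G -> cvg G.
Proof.
move=> /finite_dimensional_coordinates[n [L [co [C [lL lco Lc coK [LK [C0 coC]]]]]]].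
move=> G GF /cauchyP cG.
have : cauchy (co @ G).
  apply/cauchyP => e e0; have [x Gx] := cG (e / C) (divr_gt0 e0 C0).
  exists (co x); change (G (co @^-1` ball (co x) e)).
  apply: filterS Gx => y; rewrite -ball_normE /= => xy.
  change (ball (co x) e (co y)); rewrite -ball_normE /=.
  rewrite -(linB _ _ lco); apply: le_lt_trans (coC _) _.
  by rewrite mulrC -ltr_pdivlMr.
move=> /cauchy_cvg /cvg_ex[v /= cv].
apply/cvg_ex; exists (L v).
have Lv : L (co x) @[x --> G] --> L v := cvg_comp co L cv (Lc v).
move=> W WLv; have GW : G ((fun x => L (co x)) @^-1` W) := Lv W WLv.
change (G W); apply: filterS GW => x /=; by rewrite coK.
Qed.

(** In coordinates [T] is right multiplication by a matrix [A], and [A *m pinvmx A *m A = A]. *)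
Lemma finite_dimensional_generalized_inverse (E F : normedModType R) (T : E -> F) :
  finite_dimensional E -> finite_dimensional F -> linear T ->
  exists S, generalized_inverse T S.
Proof.
move=> /finite_dimensional_coordinates[n [L [co [_ [lL lco Lc coK [LK _]]]]]].
move=> /finite_dimensional_coordinates[p [L' [co' [C [lL' lco' Lc' coK' [LK' [C0 coC]]]]]]].
move=> lT; pose f (u : 'rV[R]_n) : 'rV[R]_p := co' (T (L u)).
have lf : linear f by move=> a u v; rewrite /f lL lT lco'.
pose f' : {linear 'rV[R]_n -> 'rV[R]_p} := HB.pack f (GRing.isLinear.Build _ _ _ _ f lf).
pose A := lin1_mx f'.
have TE x : T x = L' (co x *m A) by rewrite mul_rV_lin1 /= /f coK coK'.
exists (fun y => L (co' y *m pinvmx A)); split.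
- by move=> a u v; rewrite lco' mulmxDl -scalemxAl lL.
- have co'c : continuous co'.
    move=> y; apply/cvgrPdist_lt => e e0; have eC : 0 < e / C by rewrite divr_gt0.
    have near_y : \forall z \near y, `|y - z| < e / C by apply: cvgr_dist_lt => //; exact: cvg_id.
    apply: filterS near_y => z yz; rewrite -(linB _ _ lco').
    by apply: le_lt_trans (coC _) _; rewrite mulrC -ltr_pdivlMr.
  have pc : continuous (fun u : 'rV[R]_p => u *m pinvmx A).
    have -> : (fun u : 'rV[R]_p => u *m pinvmx A) =
        (fun u => \sum_i u 0 i *: row i (pinvmx A)).
      by apply/funext => u; exact: mulmx_sum_row.
    exact: continuous_rV_combination.
  move=> y; apply: (@continuous_comp _ _ _ co' (fun u => L (u *m pinvmx A))).
    exact: co'c.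
  apply: (@continuous_comp _ _ _ (fun u : 'rV[R]_p => u *m pinvmx A) L).
    exact: pc.
  exact: Lc.
- by move=> x; rewrite !TE LK' LK mulmxKpV // submxMl.
Qed.

End finite_dimension.

Theorem theorem3p5 (R : realType) :
  (forall (E F : completeNormedModType R) (M : manifold E) (N : manifold F)
          (f : M -> N) (m : M),
      smooth_map f -> (has_normal_form f m <-> regular_operator (tangent_map f m)))
  /\
  (forall (E F : normedModType R) (M : manifold E) (N : manifold F)
          (f : M -> N),
      finite_dimensional E -> finite_dimensional F ->
      smooth_map f -> forall m : M, has_normal_form f m).
Proof.
split=> [E F M N f m fC|E F M N f fdE fdF fC m].
  split=> [/normal_form_generalized_inverse[lT Tc [S TS]]|/regular_generalized_inverse[S TS]].
    by apply: generalized_inverse_regular TS => //; exact: model_hausdorff N.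
  exact: has_normal_form_generalized_inverse fC TS.
have [lT _] := tangent_map_linear_continuous m fC.
have [S TS] := finite_dimensional_generalized_inverse fdE fdF lT.
(* Completeness repackages [E] as a Banach space with the same underlying structure, so [M] is a
   manifold over it as well. *)
pose Ec := Uniform_isComplete.Build E (finite_dimensional_complete fdE).
pose E' : completeNormedModType R := HB.pack (NormedModule.sort E) Ec.
exact: (@has_normal_form_generalized_inverse R E' F M N f m S fC TS).
Qed.
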